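(* Suppose that Assumptions A and C hold for the $N$-player game described in the context, and that $\mathrm{VI}(X,F)$ satisfies the acute angle property: $(x-x^* )^\top F(x)>0$ for all $x\in X\setminus X^*$ and all $x^*\in X^*$. Let $\{x^k\}_{k=0}^\infty$ be generated by the stochastic asynchronous gradient-response (SAGR) scheme with the randomized stepsizes $\gamma_i^k$ defined in the context. If $X^*$ is additionally compact, then, almost surely, some subsequence of $\{x^k\}_{k=0}^\infty$ converges to a quasi-Nash equilibrium.
   Context: Game. Let $[N]=\{1,\dots,N\}$ and let $\boldsymbol{\xi}:\Omega\to\mathbb{R}^m$ be a random variable on a probability space $(\Omega,\mathcal F,\mathbb P)$ with $\Xi=\{\boldsymbol\xi(\omega)\mid\omega\in\Omega\}$. Player $i\in[N]$ has strategy set $X_i\subseteq\mathbb{R}^{n_i}$; $X=\prod_{i=1}^N X_i$, $X_{-i}=\prod_{j\ne i}X_j$, $x_{-i}=(x_j)_{j\neq i}$. Given $x_{-i}\in X_{-i}$, player $i$ solves $\min_{x_i\in X_i} f_i(x_i,x_{-i})=\mathbb E[\tilde f_i(x_i,x_{-i},\boldsymbol\xi)]$, where $\tilde f_i:X\times\Xi\to\mathbb R$. Put $F(x)=(\nabla_{x_i}f_i(x_i,x_{-i}))_{i=1}^N$. $\mathrm{VI}(X,F)$: find $x^*\in X$ with $F(x^* )^\top(x-x^* )\ge 0$ for all $x\in X$; its solution set is $X^*$. A point $x^*\in X$ is a quasi-Nash equilibrium (QNE) if $\nabla_{x_i}f_i(x_i^*,x_{-i}^* )^\top(x_i-x_i^*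 )\ge0$ for all $x_i\in X_i$ and all $i\in[N]$; equivalently $x^*\in X^*$. Assumption A. (A1) Each $X_i$ is convex and closed. (A2) For each $i$ and each $x_{-i}\in X_{-i}$, $f_i(\bullet,x_{-i})$ is $C^1$ on an open set $\mathcal O_i\supseteq X_i$ and $\nabla_{x_i}f_i(x_i,x_{-i})=\mathbb E[\nabla_{x_i}\tilde f_i(x_i,x_{-i},\boldsymbol\xi)]$. (A3) $X^*$ is closed and nonempty. SAGR scheme. Given $x^0\in X$, at each iteration $k\ge0$ a single player $i(k)$ is selected at random (independently across iterations), player $i$ being selected with probability $p_i>0$, $\sum_{i=1}^Np_i=1$. With a realization $\xi^k_{i(k)}$ of $\boldsymbol\xi$, player $i(k)$ updates $x_{i(k)}^{k+1}=\Pi_{X_{i(k)}}[x_{i(k)}^k-\gamma_{i(k)}^k\nabla_{x_{i(k)}}\tilde f_{i(k)}(x_{i(k)}^k,x_{-i(k)}^k,\xi_{i(k)}^k)]$, while $x_j^{k+1}=x_j^k$ for $j\ne i(k)$; $\Pi$ is Euclidean projection. Stepsizes: $\gamma_i^k=1/\Gamma_k(i)$ if $\Gamma_k(i)\neq0$ and $\gamma_i^k=0$ if $\Gamma_k(i)=0$, where $\Gamma_k(i)$ is the number of updates player $i$ has performed until and including iteration $k$. Histories: $\mathcal F_k=\sigma\{x^0,\cup_{t=0}^{k-1}\{i(t),\nabla_{x_{i(t)}}\tilde f_{i(t)}(x^t,\xi_{i(t)}^t)\}\}$ and $\mathcal F_{k+1/2}=\mathcal F_k\cup\{i(k)\}$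 (the history augmented by $i(k)$). Assumption C. Let $w_{i(k)}^k=\nabla_{x_{i(k)}}\tilde f_{i(k)}(x_{i(k)}^k,x_{-i(k)}^k,\xi_{i(k)}^k)-\nabla_{x_{i(k)}}\mathbb E[\tilde f_{i(k)}(x_{i(k)}^k,x_{-i(k)}^k,\boldsymbol\xi)\mid\mathcal F_{k+1/2}]$. (C1) $\mathbb E[w_{i(k)}^k\mid\mathcal F_{k+1/2}]=0$ for all $k\ge0$. (C2) $\mathbb E[\|w_{i(k)}^k\|^2\mid\mathcal F_{k+1/2}]\le M_{w,i(k)}^2$ for all $k\ge0$, for some $M_{w,i(k)}>0$. (C3) For each $i\in[N]$, $\|\nabla_{x_i}f_i(x_i,x_{-i})\|\le M_{F,i}$ for all $x\in X$ and some $M_{F,i}>0$.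
   Formalization: The map F is additionally assumed continuous on X; (A2) gives continuity of each gradient only in the player's own strategy, and without joint continuity the claim fails, e.g. F(x)=(a(x_2)x_1, x_2/2) on [0,1]^2 with a(0)=1, a(t)=t/4 for t>0. *)

(* Defs.v *)
From HB Require Import structures.
From mathcomp Require Import all_boot all_order all_algebra.
From mathcomp Require Import all_classical all_reals all_analysis.

Set Implicit Arguments.
Unset Strict Implicit.
Unset Printing Implicit Defensive.

Import Order.TTheory GRing.Theory Num.Theory.
Import numFieldNormedType.Exports.

Local Open Scope classical_set_scope.
Local Open Scope ring_scope.

(* The library norm on row vectors is the sup norm (same topology), hence the
   Euclidean structure below. *)
Definition dot (R : realType) (p : nat) (u v : 'rV[R]_p) : R :=
  \sum_(j < p) u 0 j * v 0 j.

Definition enorm (R : realType) (p : nat) (u : 'rV[R]_p) : R :=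
  Num.sqrt (dot u u).

(* Total via [get]; for C nonempty, closed and convex the minimizer exists and
   is unique. *)
Definition eproj (R : realType) (p : nat) (C : set 'rV[R]_p) (x : 'rV[R]_p) :
    'rV[R]_p :=
  get [set y | C y /\ forall z, C z -> enorm (x - y) <= enorm (x - z)].

Definition grad (R : realType) (p : nat) (g : 'rV[R]_p -> R) (y : 'rV[R]_p) :
    'rV[R]_p :=
  \row_j 'D_(delta_mx 0 j) g y.

Definition C1_on (R : realType) (p : nat) (O : set 'rV[R]_p)
    (g : 'rV[R]_p -> R) : Prop :=
  forall y, O y -> differentiable g y /\ {for y, continuous (grad g)}.

Section Probability.
Context {d : measure_display} {T : measurableType d} {R : realType}.
Variable P : probability T R.

Definition borel_rV (p : nat) : set (set 'rV[R]_p) := <<s @open 'rV[R]_p >>.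

Definition random_vector (p : nat) (V : T -> 'rV[R]_p) : Prop :=
  forall B, borel_rV B -> measurable (V @^-1` B).

Definition same_law (p : nat) (V W : T -> 'rV[R]_p) : Prop :=
  forall B, borel_rV B -> P (V @^-1` B) = P (W @^-1` B).

(* Y is a version of E[V | H], for H a sub-sigma-algebra of the events. *)
Definition is_condexp (H : set (set T)) (V Y : T -> R) : Prop :=
  [/\ P.-integrable setT (EFin \o V),
      P.-integrable setT (EFin \o Y),
      (forall B : set R, measurable B -> H (Y @^-1` B)) &
      forall A, H A ->
        (\int[P]_(w in A) (V w)%:E = \int[P]_(w in A) (Y w)%:E)%E].

End Probability.

(* A strategy profile is the concatenation of the players' vectors: an element
   of 'rV_(\sum_i ndim i), with i-th block [submxrow x i].  The sampled cost
   f~_i is a total function of (profile, sample); only its values at profiles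
   with x_{-i} in X_{-i}, and x_i in X_i or in the open set O_i around X_i, and
   at samples in Xi are ever constrained. *)
Record game (R : realType) (N m : nat) := Game {
  ndim : 'I_N -> nat;
  strat : forall i : 'I_N, set 'rV[R]_(ndim i);
  cost : 'I_N -> 'rV[R]_(\sum_(i < N) ndim i) -> 'rV[R]_m -> R
}.

Arguments strat {R N m} g i.
Arguments cost {R N m} g i.

Section Game.
Context {d : measure_display} {T : measurableType d} {R : realType}.
Context {N m : nat}.
Variables (P : probability T R) (G : game R N m) (xi : T -> 'rV[R]_m).

Local Notation prof := 'rV[R]_(\sum_(i < N) ndim G i).

Definition blk (x : prof) (i : 'I_N) : 'rV[R]_(ndim G i) := submxrow x i.

(* (y, x_{-i}) *)
Definition upd (x : prof) (i : 'I_N) (y : 'rV[R]_(ndim G i)) : prof :=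
  \mxrow_(j < N) dfwith (blk x) i y j.

Definition at_blk (i : 'I_N) (v : 'rV[R]_(ndim G i)) : prof := upd 0 v.

Definition pgrad (i : 'I_N) (h : prof -> R) (x : prof) : 'rV[R]_(ndim G i) :=
  grad (fun y => h (upd x y)) (blk x i).

Definition feasible : set prof := [set x | forall i, strat G i (blk x i)].

Definition rivals_feasible (i : 'I_N) (x : prof) : Prop :=
  forall j, j != i -> strat G j (blk x j).

Definition mean_cost (i : 'I_N) (x : prof) : R :=
  fine ('E_P[fun w => cost G i x (xi w)])%E.

Definition grad_map (x : prof) : prof :=
  \mxrow_(i < N) pgrad i (mean_cost i) x.

Definition VI_sol (n : nat) (K : set 'rV[R]_n) (F : 'rV[R]_n -> 'rV[R]_n) :
    set 'rV[R]_n :=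
  [set x | K x /\ forall y, K y -> 0 <= dot (F x) (y - x)].

Definition acute_angle (n : nat) (K : set 'rV[R]_n)
    (F : 'rV[R]_n -> 'rV[R]_n) : Prop :=
  forall x xs, (K `\` VI_sol K F) x -> VI_sol K F xs -> 0 < dot (x - xs) (F x).

Definition QNE : set prof :=
  [set x | feasible x /\ forall (i : 'I_N) (y : 'rV[R]_(ndim G i)), strat G i y ->
     0 <= dot (pgrad i (mean_cost i) x) (y - blk x i)].

Record assumptionA : Prop := AssumptionA {
  A1 : forall i : 'I_N,
    convex_set (strat G i) /\ closed (strat G i);
  A2_C1 : forall (i : 'I_N) (x : prof), rivals_feasible i x ->
    exists O : set 'rV[R]_(ndim G i),
      [/\ open O, strat G i `<=` O,
          (forall y, O y -> P.-integrable setT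
             (EFin \o (fun w => cost G i (upd x y) (xi w)))) &
          C1_on O (fun y => mean_cost i (upd x y))];
  A2_diff : forall (i : 'I_N) (x : prof) (z : 'rV[R]_m),
    feasible x -> range xi z ->
    differentiable (fun y => cost G i (upd x y) z) (blk x i);
  A2_interchange : forall (i : 'I_N) (x : prof) (j : 'I_(ndim G i)),
    feasible x ->
    let g w := pgrad i (fun x' => cost G i x' (xi w)) x 0 j in
    P.-integrable setT (EFin \o g) /\
    (pgrad i (mean_cost i) x 0 j)%:E = ('E_P[g])%E;
  A3 : closed (VI_sol feasible grad_map) /\ VI_sol feasible grad_map !=set0
}.

(* sel k = i(k), smp k = the realization of xi drawn at iteration k. *)
Variables (sel : nat -> T -> 'I_N) (smp : nat -> T -> 'rV[R]_m)
  (x : nat -> T -> prof).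

(* Gamma_k(i), counting iteration k itself. *)
Definition nupdates (k : nat) (i : 'I_N) (w : T) : nat :=
  (\sum_(t < k.+1) (sel t w == i))%N.

Definition stepsize (k : nat) (i : 'I_N) (w : T) : R :=
  if nupdates k i w == 0%N then 0 else (nupdates k i w)%:R^-1.

(* The gradient sampled at iteration k lives in a space depending on i(k); it
   is embedded in the profile space, in block i(k) and zero elsewhere.  So is
   the error w^k below. *)
Definition sgrad (k : nat) (w : T) : prof :=
  at_blk (pgrad (sel k w) (fun x' => cost G (sel k w) x' (smp k w)) (x k w)).

(* F_k *)
Definition history (k : nat) : set (set T) :=
  <<s [set A | (exists2 B, borel_rV B & A = x 0%N @^-1` B) \/
        exists2 t, (t < k)%N &
          (exists i, A = [set w | sel t w = i]) \/
          (exists2 B, borel_rV B & A = sgrad t @^-1` B)] >>.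

(* F_{k+1/2} *)
Definition history_half (k : nat) : set (set T) :=
  <<s history k `|` [set A | exists i, A = [set w | sel k w = i]] >>.

(* The draw of i(k) is independent of the whole past F_k, which contains
   i(0), ..., i(k-1): this entails mutual independence of the draws. *)
Record SAGR (p : 'I_N -> R) : Prop := MkSAGR {
  p_gt0 : forall i, 0 < p i;
  p_sum1 : \sum_(i < N) p i = 1;
  sel_measurable : forall k i, measurable [set w | sel k w = i];
  sel_indep : forall k i A, history k A ->
    P (A `&` [set w | sel k w = i]) = (P A * (p i)%:E)%E;
  smp_rv : forall k, random_vector (smp k);
  smp_range : forall k w, range xi (smp k w);
  smp_law : forall k, same_law P (smp k) xi;
  sgrad_rv : forall k, random_vector (sgrad k);
  init_rv : random_vector (x 0%N);
  init_feasible : forall w, feasible (x 0%N w);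
  step_sel : forall k w, let i := sel k w in
    blk (x k.+1 w) i =
      eproj (strat G i)
        (blk (x k w) i - stepsize k i w *: blk (sgrad k w) i);
  step_other : forall k w j, j != sel k w -> blk (x k.+1 w) j = blk (x k w) j
}.

(* In E[f~_i(x^k, xi) | F_{k+1/2}], with i = i(k), the iterate is known from
   the history and xi is a fresh draw, so the expectation is over xi alone with
   x^k frozen, i.e. f_i at x^k. *)
Definition noise (k : nat) (w : T) : prof :=
  sgrad k w - at_blk (pgrad (sel k w) (mean_cost (sel k w)) (x k w)).

Record assumptionC : Prop := AssumptionC {
  C1 : forall k j,
    is_condexp P (history_half k) (fun w => noise k w 0 j) (cst 0);
  C2 : exists2 Mw : 'I_N -> R, (forall i, 0 < Mw i) &
    forall k, exists2 Y : T -> R,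
      is_condexp P (history_half k) (fun w => enorm (noise k w) ^+ 2) Y &
      {ae P, forall w, Y w <= Mw (sel k w) ^+ 2};
  C3 : forall i : 'I_N, exists2 MF : R, 0 < MF &
    forall y, feasible y -> enorm (pgrad i (mean_cost i) y) <= MF
}.

End Game.

Arguments feasible {R N m} G.
Arguments VI_sol {R n} K F.
Arguments grad_map {d T R N m} P G xi.
Arguments QNE {d T R N m} P G xi.

(* Main.v *)
Require Import Defs.
From HB Require Import structures.
From mathcomp Require Import all_boot all_order all_algebra.
From mathcomp Require Import all_classical all_reals all_analysis.
From mathcomp Require Import measurable_realfun ring lra.

(** The squared distance of the iterates to a fixed solution [xs] is a perturbed
    supermartingale. At iteration [k] the active player [i] moves along a sampled
    gradient; projecting only brings the iterate closer to [xs]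
    ([step_distance]), the noise vanishes in the mean, and player [i] is active
    with probability [p i]. Hence the distance decreases in the mean by twice
    the sum over [i] of [p i * gain i] times the slope of player [i], up to
    second-order terms of the order of [gain i ^ 2].

    The gains are random: the gain of player [i] is the inverse of one plus its
    number of past updates. That number has mean [k * p i] and variance at most
    [k], so almost surely [p i * gain i] differs from [1 / (k + 1)] by a summable
    error and the squares of the gains are summable ([stepsize_sums_ae]). In the
    mean all players therefore use the common stepsize [1 / (k + 1)], and the sum
    of their slopes is the drift, the inner product of [x k - xs] with [F (x k)].
    It is nonnegative, also at solutions ([acute_angle_ge0]). All the errors are
    bounded by [growth k] times one plus the squared distance, with [growth k]
    known before iteration [k] and almost surely summable ([cumul_ae]).

    Dividing by the exponential of the accumulated growth gives a nonnegative
    supermartingale ([supermartingale_step]). A maximal inequality, obtained by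
    telescoping over the events of not having exceeded a level, shows that it is
    almost surely bounded and that the drifts weighted by [1 / (k + 1)] are
    summable ([supermartingale_ae]). So almost surely the iterates are bounded
    and, the harmonic series being divergent, the drift is small infinitely
    often: a cluster point of these times has zero drift, and the acute angle
    property leaves it no choice but to be a solution ([vi_subsequence]).

    Conditional expectations occur only through [expect_orthogonal]: a variable
    whose integral vanishes on every event of a sigma-algebra is orthogonal to
    the bounded variables measurable for it. *)

Set Implicit Arguments.
Unset Strict Implicit.
Unset Printing Implicit Defensive.

Import Order.TTheory GRing.Theory Num.Theory.
Import numFieldNormedType.Exports.

Local Open Scope classical_set_scope.
Local Open Scope ring_scope.

(** * Euclidean geometry and projections *)

Section Euclid.
Context {R : realType} {p : nat}.
Implicit Types (u v w : 'rV[R]_p) (C : set 'rV[R]_p).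

Lemma dotC u v : dot u v = dot v u.
Proof. by apply: eq_bigr => j _; rewrite mulrC. Qed.

Lemma dotDl u v w : dot (u + v) w = dot u w + dot v w.
Proof. by rewrite -big_split; apply: eq_bigr => j _; rewrite mxE mulrDl. Qed.

Lemma dotZl a u v : dot (a *: u) v = a * dot u v.
Proof. by rewrite mulr_sumr; apply: eq_bigr => j _; rewrite mxE mulrA. Qed.

Lemma dotNl u v : dot (- u) v = - dot u v.
Proof. by rewrite -scaleN1r dotZl mulN1r. Qed.

Lemma dotNr u v : dot u (- v) = - dot u v.
Proof. by rewrite dotC dotNl dotC. Qed.

Lemma dotDr u v w : dot w (u + v) = dot w u + dot w v.
Proof. by rewrite dotC dotDl !(dotC w). Qed.

Lemma dotZr a u v : dot u (a *: v) = a * dot u v.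
Proof. by rewrite dotC dotZl dotC. Qed.

Definition dotE := (dotDl, dotDr, dotZl, dotZr, dotNl, dotNr).

Lemma dot_ge0 u : 0 <= dot u u.
Proof. by apply: sumr_ge0 => j _; rewrite -expr2 sqr_ge0. Qed.

Lemma enorm_sqr u : enorm u ^+ 2 = dot u u.
Proof. by rewrite sqr_sqrtr// dot_ge0. Qed.

Lemma enorm_le u v : (enorm u <= enorm v) = (dot u u <= dot v v).
Proof. by rewrite ler_sqrt// dot_ge0. Qed.

Lemma dot_subZ t u v : dot (u - t *: v) (u - t *: v) =
  dot u u - 2 * t * dot u v + t ^+ 2 * dot v v.
Proof. by rewrite !dotE (dotC v u); ring. Qed.

Lemma coord_le_dot u j : u 0 j ^+ 2 <= dot u u.
Proof.
rewrite /dot (bigD1 j)//= expr2 lerDl.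
by apply: sumr_ge0 => i _; rewrite -expr2 sqr_ge0.
Qed.

(** Expand the squares of [u + v] and [u - v]; this crude form of the
    Cauchy-Schwarz inequality is enough because its right-hand side will be
    absorbed in a potential that is at least one. *)
Lemma dot_le_sum_sqr u v : `|dot u v| <= (dot u u + dot v v) / 2.
Proof.
have h1 := dot_ge0 (u + v); have h2 := dot_ge0 (u - v).
rewrite ler_norml; move: h1 h2; rewrite !dotE (dotC v u) => h1 h2.
by apply/andP; split; lra.
Qed.

Lemma dotD_le u v : dot (u + v) (u + v) <= 2 * dot u u + 2 * dot v v.
Proof.
have := dot_ge0 (u - v); rewrite !dotE (dotC v u); lra.
Qed.

Lemma dist2_continuous u : continuous (fun v => dot (u - v) (u - v)).
Proof.
apply: continuous_big => [|j _ v]; first exact: add_continuous.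
suff h : continuous (fun v => (u - v) 0 j) by move: (h v) => hv; exact: (cvgM hv hv).
rewrite (_ : (fun v => _) = (fun v => u 0 j - v 0 j)); last first.
  by apply/funext => v'; rewrite !mxE.
by move=> v'; exact: (cvgB (cvg_cst _) (@coord_continuous _ _ _ 0 j v')).
Qed.

Lemma dot_bounded_set (u : 'rV[R]_p) r :
  bounded_set [set v | dot (u - v) (u - v) <= r].
Proof.
exists (`|u| + r + 1); split; first exact: num_real.
move=> M HM v /= Hv.
have uvle : `|u - v| <= r + 1.
  have r0 : 0 <= r by apply: le_trans Hv; exact: dot_ge0.
  rewrite [leLHS]/Num.norm /= mx_normrE.
  apply: bigmax_le => [|[i j] _ /=]; first by lra.
  rewrite ord1.
  have := le_trans (coord_le_dot (u - v) j) Hv.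
  rewrite -[X in X <= _]real_normK ?num_real//.
  have := normr_ge0 ((u - v) 0 j); nra.
have : `|v| <= `|u| + `|u - v|.
  by rewrite -{1}[v](subKr u); exact: ler_normB.
lra.
Qed.

(** Only the points of [C] at least as close to [u] as a given member compete, and
    they form a compact set. *)
Lemma eproj_exists C u : closed C -> C !=set0 ->
  exists y, C y /\ forall z, C z -> enorm (u - y) <= enorm (u - z).
Proof.
move=> clC [c Cc].
pose A := C `&` [set v | dot (u - v) (u - v) <= dot (u - c) (u - c)].
have cptA : compact A.
  apply: bounded_closed_compact.
    have [M [Mr HM]] := dot_bounded_set u (dot (u - c) (u - c)).
    by exists M; split => // N MN v [_]; exact: HM.
  apply: closedI => //.
  rewrite (_ : [set v | _] = (fun v => dot (u - v) (u - v)) @^-1`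
    [set r | r <= dot (u - c) (u - c)])//.
  by apply: closed_comp => [x _|]; [exact: dist2_continuous|exact: closed_le].
have [||y] := @compact_EVT_min _ _ (fun v => dot (u - v) (u - v)) A _ cptA.
- by exists c; split => //=.
- by apply: continuous_subspaceT => x; exact: dist2_continuous.
- rewrite inE => -[Cy yc] ymin; exists y; split => // z Cz.
  rewrite enorm_le; have [zc|/ltW zc] := leP (dot (u - z) (u - z)) (dot (u - c) (u - c)).
    by apply: ymin; rewrite inE.
  exact: le_trans zc.
Qed.

Lemma convex_segment C u v (t : R) : convex_set C -> C u -> C v ->
  0 <= t -> t <= 1 -> C (u + t *: (v - u)).
Proof.
move=> convC Cu Cv t0 t1.
have t01 : Itv.spec (@Itv.num_sem _) (Itv.Real `[0%Z, 1%Z]) t.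
  by rewrite /= /Itv.num_sem/= num_real/= in_itv/= t0 t1.
have := @convC v u (Itv.mk t01); rewrite !inE => /(_ Cv Cu).
rewrite /conv/= (_ : _ *: v + _ = u + t *: (v - u))//.
by rewrite /unstable.onem scalerBl scalerBr scale1r addrCA.
Qed.

Section Projection.
Variable C : set 'rV[R]_p.
Hypotheses (convC : convex_set C) (clC : closed C) (C0 : C !=set0).

Lemma eprojP u :
  C (eproj C u) /\
  forall z, C z -> dot (u - eproj C u) (u - eproj C u) <= dot (u - z) (u - z).
Proof.
have [y yP] := eproj_exists u clC C0.
have [Cy ymin] : [set y | C y /\ forall z, C z -> enorm (u - y) <= enorm (u - z)]
  (eproj C u) by rewrite /eproj; case: xgetP => [? -> //|/(_ y)].
by split=> // z Cz; rewrite -enorm_le; exact: ymin.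
Qed.

(** Moving from the projection towards [z] by a small step [t] cannot decrease the
    squared distance to [u], whose derivative at [t = 0] is [- 2 * a]. *)
Lemma eproj_obtuse u z : C z -> dot (u - eproj C u) (z - eproj C u) <= 0.
Proof.
move=> Cz; have [Cq qmin] := eprojP u.
set q := eproj C u in Cq qmin *; set a := dot _ _.
rewrite leNgt; apply/negP => a0.
set b := dot (z - q) (z - q); have b0 : 0 <= b by exact: dot_ge0.
have ab0 : 0 < a + b by lra.
(* Any [t] with [t * b < 2 * a] would do; this one is also at most one. *)
pose t := a / (a + b).
have t0 : 0 <= t by rewrite /t divr_ge0; lra.
have t1 : t <= 1 by rewrite /t ler_pdivrMr//; lra.
have Ct : C (q + t *: (z - q)) by exact: convex_segment.
have := qmin _ Ct.
rewrite opprD addrA dot_subZ -/a -/b => h.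
have : t * (2 * a) <= t * (t * b) by lra.
have tp : 0 < t by rewrite /t divr_gt0.
rewrite ler_pM2l// => h2.
have : t * (a + b) = a by rewrite /t divfK// lt0r_neq0.
nra.
Qed.

(** At the projection the angle between the point and a member is obtuse, so the
    side opposite to it is the longest. *)
Lemma eproj_closer u z : C z ->
  dot (eproj C u - z) (eproj C u - z) <= dot (u - z) (u - z).
Proof.
move=> Cz; have h := eproj_obtuse u Cz; have h2 := dot_ge0 (u - eproj C u).
move: h h2; set q := eproj C u.
rewrite (_ : u - z = (u - q) - (z - q)); last by rewrite opprB addrA subrK.
rewrite -(opprB z q); move: (u - q) (z - q) => v w.
rewrite !dotE (dotC w v); lra.
Qed.

Lemma eproj_nonexpansive u v :
  dot (eproj C u - eproj C v) (eproj C u - eproj C v) <= dot (u - v) (u - v).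
Proof.
have [Cu _] := eprojP u; have [Cv _] := eprojP v.
have := eproj_obtuse u Cv; have := eproj_obtuse v Cu.
move: (eproj C u) (eproj C v) => a b h1 h2.
have := dot_ge0 ((u - v) - (a - b)).
move: h1 h2; rewrite !dotE.
rewrite !(dotC v) !(dotC a) !(dotC b) !(dotC u); lra.
Qed.

Lemma eproj_continuous : continuous (eproj C).
Proof.
move=> u B /= /(nbhs_ballP (eproj C u))[e e0 eB].
have /cvgrPdist_lt/(_ (e ^+ 2)) := @dist2_continuous u u.
rewrite exprn_gt0// => /(_ isT); apply: filterS => v.
rewrite subrr {1}/dot big1; last by move=> j _; rewrite mxE mul0r.
rewrite sub0r normrN ger0_norm ?dot_ge0// => uv; apply: eB.
split=> // i j; rewrite ord1 /ball/=.
have /le_lt_trans := le_trans (coord_le_dot _ j) (eproj_nonexpansive u v).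
move=> /(_ _ uv); rewrite !mxE -[X in X < _]real_normK ?num_real//.
by rewrite ltr_pXn2r// nnegrE ?normr_ge0// ltW.
Qed.

End Projection.
End Euclid.

(** * Measurability of random vectors *)

Section VectorMeasurability.
Context {d : measure_display} {T : measurableType d} {R : realType} {p : nat}.
Implicit Types (V : T -> 'rV[R]_p).

Definition coord_measurable V :=
  forall j, measurable_fun setT (fun w => V w 0 j).

(** An open set is the union of the countably many sup-norm balls with rational
    center and radius [1 / (n + 1)] that it contains, and the preimage of a ball
    is a finite intersection of preimages of intervals by the coordinates. *)
Lemma measurable_preimage_open V U :
  coord_measurable V -> open U -> measurable (V @^-1` U).
Proof.
move=> mV oU.
pose r n : R := n.+1%:R^-1.
have r0 n : 0 < r n by rewrite invr_gt0 ltr0n.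
pose c (q : 'rV[rat]_p) : 'rV[R]_p := map_mx ratr q.
pose F (qn : 'rV[rat]_p * nat) : set T :=
  if `[< ball (c qn.1) (r qn.2) `<=` U >] then V @^-1` ball (c qn.1) (r qn.2)
  else set0.
rewrite (_ : V @^-1` U = \bigcup_qn F qn); last first.
  apply/seteqP; split => [w Uw|w [qn _]]; last first.
    by rewrite /F; case: asboolP => // sub /sub.
  have [e e0 eU] := (nbhs_ballP _ _).1 (open_nbhs_nbhs (conj oU Uw)).
  have [n rn] : exists n, r n + r n < e.
    have [n _ /(_ n (leqnn n))] := near_infty_natSinv_lt (PosNum (divr_gt0 e0 (@ltr0n R 2))).
    by rewrite /= -/(r n) => h; exists n; rewrite [e]splitr ltrD.
  have [q qV] : exists q : 'rV[rat]_p, ball (c q) (r n) (V w).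
    have /choice[f fP] : forall j : 'I_p, exists x : rat, `|ratr x - V w 0 j| < r n.
      move=> j; have /rat_in_itvoo[x] : V w 0 j - r n < V w 0 j + r n.
        by have := r0 n; lra.
      rewrite in_itv/= => /andP[x1 x2]; exists x.
      by rewrite ltr_norml; apply/andP; split; lra.
    exists (\row_j f j); split => // i j.
    by rewrite ord1 /ball/= !mxE.
  exists (q, n) => //; rewrite /F/=.
  case: asboolP => //; case=> v qv; apply: eU.
  by apply: (le_ball (ltW rn)); apply: (ball_triangle _ qv); exact: ball_sym.
apply: countable_bigcupT_measurable; first exact: countableP.
move=> [q n].
rewrite /F/=; case: asboolP => // _.
rewrite (_ : V @^-1` _ =
    \bigcap_(j in [set: 'I_p]) ((fun w => V w 0 j) @^-1` ball (c q 0 j) (r n))).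
  rewrite -[X in measurable X]setCK setC_bigcap; apply: measurableC.
  apply: fin_bigcup_measurable => // j _; apply: measurableC.
  rewrite -[X in measurable X]setTI; apply: mV => //; exact: measurable_ball.
apply/seteqP; split => w; first by move=> [_ h] j _; exact: h.
by move=> h; split=> // i j; rewrite ord1; exact: (h j).
Qed.

Lemma coord_measurableP V :
  (forall U, open U -> measurable (V @^-1` U)) -> coord_measurable V.
Proof.
move=> mV j; apply: (measurability _ (RGenOpens.measurableE R)).
move=> _ [_ [a [b ->] <-]]; rewrite setTI.
apply: (mV ((fun v : 'rV[R]_p => v 0 j) @^-1` `]a, b[%classic)).
by apply: open_comp => [v _|]; [exact: coord_continuous|exact: interval_open].
Qed.

(** The preimage of an open interval by [f] is the trace on [D] of an open set, and
    [V] takes all its values in [D]. *)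
Lemma measurable_continuous_within V (D : set 'rV[R]_p) (f : 'rV[R]_p -> R) :
  coord_measurable V -> (forall w, D (V w)) -> {within D, continuous f} ->
  measurable_fun setT (fun w => f (V w)).
Proof.
move=> mV DV cf; apply: (measurability _ (RGenOpens.measurableE R)).
move=> _ [_ [a [b ->] <-]]; rewrite setTI.
have /(_ `]a, b[%classic (@interval_open _ (BRight a) (BLeft b) isT isT)) :=
  (continuousP _).1 cf.
move=> /open_subspaceP [W oW WD].
rewrite [X in measurable X](_ : _ = V @^-1` W); first exact: measurable_preimage_open.
apply/seteqP; split => w Hw.
  have : (W `&` D) (V w) by rewrite WD; split => //; exact: DV.
  by case.
have : (W `&` D) (V w) by split => //; exact: DV.
by rewrite WD => -[].
Qed.

Lemma coord_measurable_continuous q V (f : 'rV[R]_p -> 'rV[R]_q) :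
  coord_measurable V -> continuous f ->
  forall j, measurable_fun setT (fun w => f (V w) 0 j).
Proof.
move=> mV cf j; apply: (@measurable_continuous_within _ setT (fun v => f v 0 j)) => //.
apply: continuous_subspaceT => v.
exact: (continuous_comp (cf v) (@coord_continuous _ _ _ 0 j _)).
Qed.

End VectorMeasurability.

(** * Expectations and adapted variables *)

Section Expectation.
Context {d : measure_display} {T : measurableType d} {R : realType}.
Variable P : probability T R.
Implicit Types (f g h v : T -> R) (M c : R) (n : nat) (A : set T) (G : set (set T)).

Definition integrable_rv f := P.-integrable setT (EFin \o f).

Lemma summable_bounded f M :
  measurable_fun setT f -> (forall w, `|f w| <= M) -> integrable_rv f.
Proof.
move=> mf fM; apply: measurable_bounded_integrable => //.
  by rewrite (le_lt_trans (probability_le1 P measurableT))// ltry.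
by exists M; split=> [|x Mx w _]; [exact: num_real|exact: le_trans (fM w) (ltW Mx)].
Qed.

Lemma integrable_rvM h v M :
  measurable_fun setT h -> (forall w, `|h w| <= M) -> integrable_rv v ->
  integrable_rv (fun w => h w * v w).
Proof.
move=> mh hM iv; apply: (@integrableMr _ _ _ P _ measurableT h _ mh _ iv).
by exists M; split=> [|x Mx w _]; [exact: num_real|exact: le_trans (hM w) (ltW Mx)].
Qed.

Lemma integrable_rvD f g :
  integrable_rv f -> integrable_rv g -> integrable_rv (fun w => f w + g w).
Proof. by move=> fi gi; exact: (integrableD measurableT fi gi). Qed.

Lemma integrable_rvZ a f : integrable_rv f -> integrable_rv (fun w => a * f w).
Proof. by move=> fi; exact: (integrableZl measurableT a fi). Qed.

Lemma integrable_rvB f g :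
  integrable_rv f -> integrable_rv g -> integrable_rv (fun w => f w - g w).
Proof. by move=> fi gi; exact: (integrableB measurableT fi gi). Qed.

Lemma integrable_rv_sum (I : Type) (s : seq I) (F : I -> T -> R) :
  (forall i, integrable_rv (F i)) -> integrable_rv (fun w => \sum_(i <- s) F i w).
Proof.
move=> Fi; rewrite /integrable_rv (_ : _ \o _ =
  (fun w => (\sum_(i <- s) (F i w)%:E)%E)).
  by apply: integrable_sum => // i _; exact: Fi.
by apply/funext => w; rewrite /= -sumEFin.
Qed.

Lemma expect_sum (I : Type) (s : seq I) (F : I -> T -> R) :
  (forall i, integrable_rv (F i)) ->
  \int[P]_w (\sum_(i <- s) F i w) = \sum_(i <- s) \int[P]_w F i w.
Proof.
move=> Fi; elim: s => [|i s IH].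
  under eq_Rintegral do rewrite big_nil.
  by rewrite Rintegral_cst// mul0r big_nil.
under eq_Rintegral do rewrite big_cons.
by rewrite RintegralD//; [rewrite IH big_cons|exact: Fi|exact: integrable_rv_sum].
Qed.

Lemma expect_cst (c : R) : \int[P]_w c = c.
Proof.
rewrite Rintegral_cst// -[RHS]mulr1; congr (_ * _).
rewrite -[RHS]/(fine 1%E); congr fine.
exact: probability_setT.
Qed.

Lemma EFin_expect f : integrable_rv f ->
  (\int[P]_w f w)%:E = (\int[P]_w (f w)%:E)%E.
Proof. by move=> fi; rewrite fineK//; exact: integrable_fin_num. Qed.

(** Stated on the space that carries the generated sigma-algebra, so that the
    closure properties of measurable functions apply. *)
Definition adapted G (f : T -> R) :=
  @measurable_fun _ _ (g_sigma_algebraType G) R setT f.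

Lemma adapted_measurable G f :
  <<s G >> `<=` measurable -> adapted G f -> measurable_fun setT f.
Proof. by move=> sub mf _ B mB; apply: sub; exact: mf. Qed.

Lemma adaptedS G G' f : <<s G >> `<=` <<s G' >> -> adapted G f -> adapted G' f.
Proof. by move=> sub mf mT B mB; apply: sub; exact: mf. Qed.

Lemma adapted_cst G c : adapted G (cst c).
Proof. exact: measurable_cst. Qed.

Lemma adaptedD G f g :
  adapted G f -> adapted G g -> adapted G (fun w => f w + g w).
Proof. by move=> af ag; exact: (measurable_funD af ag). Qed.

Lemma adaptedB G f g :
  adapted G f -> adapted G g -> adapted G (fun w => f w - g w).
Proof. by move=> af ag; exact: (measurable_funB af ag). Qed.

Lemma adaptedM G f g :
  adapted G f -> adapted G g -> adapted G (fun w => f w * g w).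
Proof. by move=> af ag; exact: (measurable_funM af ag). Qed.

Lemma adaptedX G f n : adapted G f -> adapted G (fun w => f w ^+ n).
Proof. by move=> af; exact: (measurable_funX n af). Qed.

Lemma adapted_norm G f : adapted G f -> adapted G (fun w => `|f w|).
Proof. by move=> af; exact: (measurableT_comp (@normr_measurable R setT) af). Qed.

Lemma adapted_expR G f : adapted G f -> adapted G (fun w => expR (f w)).
Proof. by move=> af; exact: (measurableT_comp (@measurable_expR R) af). Qed.

(** On nonnegative reals the inverse is the power of exponent [-1], which is
    measurable on the whole line. *)
Lemma adaptedV G f :
  (forall w, 0 <= f w) -> adapted G f -> adapted G (fun w => (f w)^-1).
Proof.
move=> f0 af; rewrite (_ : (fun w => _) = (@powR R ^~ (-1)) \o f).
  exact: (measurableT_comp (@measurable_powR R (-1)) af).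
by apply/funext => w; rewrite /= powR_inv1.
Qed.

Lemma adapted_sum (I : finType) (Q : I -> T -> R) G :
  (forall i, adapted G (Q i)) -> adapted G (fun w => \sum_i Q i w).
Proof. by move=> aQ; exact: measurable_sum. Qed.

Lemma adapted_indic G A : <<s G >> A -> adapted G (\1_A).
Proof. by move=> sA; exact: (@measurable_indic _ (g_sigma_algebraType G)). Qed.

(** Every use of a conditional expectation goes through this orthogonality. The
    bounded variable is rounded down to a multiple of [1 / (n + 1)], which costs
    at most [1 / (n + 1)] times the mean of [`|v|]; the rounded variable takes
    finitely many values, each on an event of the sigma-algebra. *)
Lemma expect_orthogonal G h v M :
  <<s G >> `<=` measurable -> adapted G h -> (forall w, `|h w| <= M) ->
  integrable_rv v ->
  (forall A, <<s G >> A -> (\int[P]_(w in A) (v w)%:E = 0)%E) ->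
  \int[P]_w (h w * v w) = 0.
Proof.
move=> sub mh hM iv v0.
have mhT := adapted_measurable sub mh.
have M0 : 0 <= M.
  by apply: le_trans (hM point); exact: normr_ge0.
set I := \int[P]_w _.
have iav : integrable_rv (fun w => `|v w|) by exact: integrable_norm.
set c := \int[P]_w `|v w|.
have c0 : 0 <= c by apply: Rintegral_ge0 => w _.
suff Ic n : `|I| <= n.+1%:R^-1 * c.
  apply/eqP; rewrite -normr_le0; apply/ler_addgt0Pl => e e0; rewrite addr0.
  have [n _ /(_ n (leqnn n))] := near_infty_natSinv_lt
    (PosNum (divr_gt0 e0 (ltr_pwDr ltr01 c0))).
  rewrite /= ltr_pdivlMr; last by rewrite ltr_pwDr.
  move=> nc; apply: (le_trans (Ic n)); apply/ltW/(le_lt_trans _ nc).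
  by rewrite ler_wpM2l// ?lerDl// invr_ge0 ler0n.
pose r : R := n.+1%:R; have r0 : 0 < r by rewrite ltr0n.
pose z w := (h w + M) * r.
have z0 w : 0 <= z w.
  rewrite mulr_ge0//.
  by move: (hM w); rewrite ler_norml => /andP[]; lra.
pose N := (Num.truncn ((M + M) * r)).+1.
have zN w : (Num.truncn (z w) < N)%N.
  rewrite ltnS; apply: Num.Theory.le_truncn.
  rewrite ler_pM2r// lerD2r; exact: le_trans (ler_norm _) (hM w).
pose B (j : 'I_N) := [set w | Num.truncn (z w) = j].
have sB j : <<s G >> (B j).
  rewrite (_ : B j = setT `&` h @^-1` `[j%:R / r - M, j.+1%:R / r - M[%classic).
    by apply: mh => //; exact: measurable_itv.
  rewrite setTI; apply/seteqP; split => w.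
    rewrite /B/= => /eqP; rewrite truncn_eq// in_itv/= /z.
    by rewrite lerBlDr ltrBrDr ler_pdivrMr// ltr_pdivlMr.
  rewrite /B/= in_itv/= lerBlDr ltrBrDr ler_pdivrMr// ltr_pdivlMr// => zj.
  by apply/eqP; rewrite truncn_eq.
have mB j : measurable (B j) by exact: sub.
pose q w := (Num.truncn (z w))%:R / r - M.
have hq w : `|h w - q w| <= r^-1.
  have /andP[z1 z2] := truncn_itv (z0 w).
  have hE : h w = z w / r - M by rewrite /z mulfK ?gt_eqF// addrK.
  rewrite hE /q opprB addrA subrK -mulrBl normrM (gtr0_norm (x := r^-1)) ?invr_gt0//.
  rewrite ger_pMl ?invr_gt0// ger0_norm ?subr_ge0//.
  by move: z2; rewrite -natr1; lra.
have qE w : q w * v w = \sum_(j < N) (j%:R / r - M) * (v \_ (B j)) w.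
  rewrite (bigD1 (Ordinal (zN w)))//= big1 ?addr0.
    by rewrite patchE mem_set.
  move=> j jz; rewrite patchE memNset ?mulr0// /B/= => zj.
  by move/eqP: jz; apply; apply/val_inj.
have iB j : integrable_rv (v \_ (B j)).
  rewrite /integrable_rv -restrict_EFin; apply/integrable_restrict => //.
  by rewrite setTI; apply: integrableS iv.
have iq : integrable_rv (fun w => q w * v w).
  rewrite (_ : (fun w => _) = fun w => \sum_(j < N) (j%:R / r - M) * (v \_ (B j)) w).
    by apply: integrable_rv_sum => j; apply: integrable_rvZ.
  by apply/funext => w; rewrite qE.
have Iq : \int[P]_w (q w * v w) = 0.
  under eq_Rintegral do rewrite qE.
  rewrite expect_sum => [|j]; last by apply: integrable_rvZ.
  apply: big1 => j _; rewrite RintegralZl//; last exact: iB.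
  by rewrite -Rintegral_mkcond /Rintegral v0// mulr0.
have ih : integrable_rv (fun w => h w * v w) by exact: integrable_rvM hM iv.
have -> : I = \int[P]_w (h w * v w - q w * v w) by rewrite RintegralB// Iq subr0.
have ihq := integrable_rvB ih iq.
apply: (le_trans (le_normr_Rintegral measurableT ihq)).
rewrite -RintegralZl//; apply: le_Rintegral => //.
- exact: (integrable_norm ihq).
- exact: integrable_rvZ.
- by move=> w _; rewrite -mulrBl normrM ler_wpM2r// hq.
Qed.

(** The difference is almost everywhere equal to its positive part. *)
Lemma expect_ae_le f g : integrable_rv f -> integrable_rv g ->
  {ae P, forall w, f w <= g w} -> \int[P]_w f w <= \int[P]_w g w.
Proof.
move=> fi gi fg; rewrite -subr_ge0 -RintegralB//.
have mgf := measurable_int _ (integrable_rvB gi fi).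
have mr : measurable_fun setT (fun w => g w - f w) by exact/measurable_EFinP.
rewrite /Rintegral (ae_eq_integral (fun w => (Num.max (g w - f w) 0)%:E))//.
- by apply: Rintegral_ge0 => w _; rewrite le_max lexx orbT.
- by apply/measurable_EFinP; apply: measurable_maxr => //; exact: measurable_cst.
- by apply: filterS fg => w fgw _; rewrite max_l// subr_ge0.
Qed.

End Expectation.

(** * Almost sure bounds for nonnegative supermartingales *)

Section Supermartingale.
Context {d : measure_display} {T : measurableType d} {R : realType}.
Variable P : probability T R.

(** By monotone convergence the sum of the series is integrable on [A], hence
    almost everywhere finite there. *)
Lemma ae_bounded_series (A : set T) (D : nat -> T -> R) (C : R) :
  measurable A -> (forall k, measurable_fun setT (D k)) ->
  (forall k w, 0 <= D k w) ->
  (forall K, (\sum_(k < K) \int[P]_(w in A) (D k w)%:E <= C%:E)%E) ->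
  {ae P, forall w, A w -> exists M : R, forall n, \sum_(k < n) D k w <= M}.
Proof.
move=> mA mD D0 DC.
pose S w := (\sum_(k <oo) (D k w)%:E)%E.
have mDA k : measurable_fun A (fun w => (D k w)%:E).
  by apply/measurable_EFinP; exact: measurable_funTS.
have intS : (\int[P]_(w in A) S w <= C%:E)%E.
  rewrite /S integral_nneseries//; last by move=> k w _; rewrite lee_fin.
  apply: lime_le.
    by apply: is_cvg_nneseries => k _ _; apply: integral_ge0 => w _; rewrite lee_fin.
  by apply: nearW => K; rewrite big_mkord.
have S0 w : (0 <= S w)%E by apply: nneseries_ge0 => k _ _; rewrite lee_fin.
have mS : measurable_fun A S.
  by apply: ge0_emeasurable_sum => // k w _ _; rewrite lee_fin.
have iS : P.-integrable A S.
  apply/integrableP; split => //; apply: le_lt_trans (ltry C).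
  by under eq_integral do rewrite gee0_abs//.
have := integrable_ae mA iS; apply: filterS => w Sfin Aw.
exists (fine (S w)) => n; rewrite -lee_fin fineK; last exact: Sfin.
by rewrite -sumEFin -(big_mkord xpredT (fun k => (D k w)%:E)); apply: nneseries_lim_ge => k _ _; rewrite lee_fin.
Qed.

Variables (G : nat -> set (set T)) (Z D : nat -> T -> R).
Hypotheses (sub : forall k, <<s G k >> `<=` measurable)
  (mono : forall k, <<s G k >> `<=` <<s G k.+1 >>)
  (Z0 : forall k w, 0 <= Z k w) (D0 : forall k w, 0 <= D k w)
  (aZ : forall k, adapted (G k) (Z k)) (mD : forall k, measurable_fun setT (D k)).
(* The supermartingale inequality is asked only on events of the past on which
   the process has stayed bounded, where all integrals are finite. *)
Hypothesis step : forall k A (M : R), <<s G k >> A ->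
  (forall w, A w -> forall t, (t <= k)%N -> Z t w <= M) ->
  (\int[P]_(w in A) (Z k.+1 w)%:E + \int[P]_(w in A) (D k w)%:E <=
   \int[P]_(w in A) (Z k w)%:E)%E.

Let mono_le j k : (j <= k)%N -> <<s G j >> `<=` <<s G k >>.
Proof.
move=> /subnK <-; elim: (k - j)%N => // i IH A /IH; rewrite addSn; exact: mono.
Qed.

Section Stopped.
Variables n m : nat.

Let E := [set w | Z 0 w <= n%:R].
Let A k := E `&` [set w | forall t, (t <= k)%N -> Z t w <= m%:R].

Let sublevel k (x : R) : <<s G k >> [set w | Z k w <= x].
Proof.
rewrite (_ : [set w | _] = setT `&` Z k @^-1` `]-oo, x]%classic).
  by apply: aZ => //; exact: measurable_itv.
by rewrite setTI; apply/seteqP; split => w /=; rewrite in_itv.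
Qed.

Let sA k : <<s G k >> (A k).
Proof.
rewrite (_ : A k = E `&` \bigcap_(t in `I_k.+1) [set w | Z t w <= m%:R]).
  apply: (@measurableI _ (g_sigma_algebraType (G k))).
    by apply: (@mono_le 0 k) => //; exact: sublevel.
  apply: (@bigcap_measurableType _ (g_sigma_algebraType (G k))) => t /= tk.
  by apply: (@mono_le t k) => //; exact: sublevel.
by [].
Qed.

Let mA k : measurable (A k). Proof. exact: sub. Qed.

Let mE : measurable E. Proof. by apply: (@sub 0); exact: sublevel. Qed.

Let A_decr k : A k.+1 `<=` A k.
Proof. by move=> w [Ew h]; split => // t tk; apply: h; exact: leqW. Qed.

Let mZ k : measurable_fun setT (Z k).
Proof. exact: (adapted_measurable (@sub k) (@aZ k)). Qed.

(** Telescoping the supermartingale inequality along the events that the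
    process has not yet exceeded [m]: the exits are paid for by the initial
    mean, as in Doob's maximal inequality. *)
Let stopped_sum K : (n <= m)%N ->
  (\sum_(k < K) \int[P]_(w in A k) (D k w)%:E +
    (m%:R%:E * P (E `\` A K) + \int[P]_(w in A K) (Z K w)%:E) <= n%:R%:E)%E.
Proof.
move=> nm; elim: K => [|K IH].
  rewrite big_ord0 add0e (_ : E `\` A 0%N = set0); last first.
    apply/seteqP; split => // w [Ew] []; split => // t.
    by rewrite leqn0 => /eqP ->; apply: (le_trans Ew); rewrite ler_nat.
  rewrite measure0 mule0 add0e.
  apply: (@le_trans _ _ (\int[P]_(w in A 0%N) n%:R%:E)%E).
    apply: ge0_le_integral => //.
    - by move=> w _; rewrite lee_fin.
    - by apply/measurable_EFinP; exact: measurable_funTS.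
    - by move=> w [Ew _]; rewrite lee_fin.
  by rewrite integral_cst// -[leRHS]mule1 lee_wpmul2l ?lee_fin// probability_le1.
apply: le_trans IH; rewrite big_ord_recr/= -addeA leeD2l//.
have AKE : E `\` A K.+1 = (E `\` A K) `|` (A K `\` A K.+1).
  apply/seteqP; split => w.
    by move=> [Ew nA]; have [Aw|nAw] := pselect (A K w); [right|left].
  by move=> [[Ew nA]|[[Ew h] nA]]; split => // /A_decr.
rewrite AKE measureU//; last 3 first.
- exact: measurableD.
- exact: measurableD.
- by apply/seteqP; split => // w [[_ ?] [? _]].
rewrite ge0_muleDr// addeCA -addeA leeD2l//.
have AK : A K = A K.+1 `|` (A K `\` A K.+1).
  by rewrite setDUK//; exact: A_decr.
have := step (@sA K) (fun w (Aw : A K w) => Aw.2).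
apply: le_trans; rewrite addeCA [leRHS]addeC leeD2l// [in leRHS]AK ge0_integral_setU//; last 4 first.
- exact: measurableD.
- by apply/measurable_EFinP; exact: measurable_funTS.
- by move=> w _; rewrite lee_fin.
- by apply/disj_setPS => w [? []].
rewrite addeC leeD2l//.
rewrite -integral_cst; last exact: measurableD.
apply: ge0_le_integral => //.
- exact: measurableD.
- by move=> w _; rewrite lee_fin.
- by apply/measurable_EFinP; exact: measurable_funTS.
- move=> w [[Ew h] nA]; rewrite lee_fin leNgt; apply/negP => Zm; apply: nA.
  split => // t; rewrite leq_eqVlt ltnS => /predU1P[->|]; last exact: h.
  exact: ltW.
Qed.

Lemma exit_measurable : measurable (E `\` \bigcap_k A k).
Proof. by apply: measurableD => //; exact: (bigcapT_measurable mA). Qed.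

(** The exits by time [k] increase to the exit event, and each has
    probability at most [n / m] by [stopped_sum]. *)
Lemma exit_probability : (n <= m)%N ->
  (m%:R%:E * P (E `\` \bigcap_k A k) <= n%:R%:E)%E.
Proof.
move=> nm; rewrite (_ : E `\` _ = \bigcup_k (E `\` A k)); last first.
  by rewrite setDE setC_bigcap setI_bigcupr; apply: eq_bigcupr => k _; rewrite setDE.
have cv : (m%:R%:E * (P \o (fun k => E `\` A k)) k)%E @[k --> \oo] -->
    (m%:R%:E * P (\bigcup_k (E `\` A k)))%E.
  apply: cvgeZl => //; apply: nondecreasing_cvg_mu.
  - by move=> k; exact: measurableD.
  - by apply: bigcupT_measurable => k; exact: measurableD.
  - by apply/nondecreasing_seqP => k; apply/subsetPset => w [Ew nA]; split => // /A_decr.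
rewrite -(cvg_lim _ cv)//; apply: lime_le; first by apply/cvg_ex; eexists; exact: cv.
apply: nearW => k /=; apply: le_trans (stopped_sum k nm).
rewrite addeCA leeDl// adde_ge0//; last by apply: integral_ge0 => w _; rewrite lee_fin.
by apply: sume_ge0 => j _; apply: integral_ge0 => w _; rewrite lee_fin.
Qed.

Lemma drift_bounded : (n <= m)%N ->
  {ae P, forall w, (\bigcap_k A k) w -> exists M : R, forall K, \sum_(k < K) D k w <= M}.
Proof.
move=> nm; apply: (@ae_bounded_series _ _ n%:R) => // [|K]; first exact: (bigcapT_measurable mA).
apply: le_trans (stopped_sum K nm).
apply: (@le_trans _ _ (\sum_(k < K) \int[P]_(w in A k) (D k w)%:E)%E).
  apply: lee_sum => k _; apply: ge0_subset_integral => //.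
  - exact: (bigcapT_measurable mA).
  - by apply/measurable_EFinP; exact: measurable_funTS.
  - by move=> w _; rewrite lee_fin.
  - by apply: bigcap_inf.
rewrite leeDl// adde_ge0//; last by apply: integral_ge0 => w _; rewrite lee_fin.
by rewrite mule_ge0.
Qed.

End Stopped.

(** Weak form of the Robbins-Siegmund theorem, without convergence of [Z]: starting
    below [n], the process exceeds [n + j] with probability at most
    [n / (n + j)], hence it almost surely stays below some level, and on that
    event the expected sum of the [D k] is at most [n]. *)
Lemma supermartingale_ae :
  {ae P, forall w, (exists M : R, forall k, Z k w <= M) /\
    exists M : R, forall K, \sum_(k < K) D k w <= M}.
Proof.
pose A n m := \bigcap_k ([set w | Z 0 w <= n%:R] `&`
  [set w | forall t, (t <= k)%N -> Z t w <= m%:R]).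
have drift : {ae P, forall w, forall n j, A n (n + j)%N w ->
    exists M : R, forall K, \sum_(k < K) D k w <= M}.
  apply: ae_foralln => n; apply: ae_foralln => j.
  by apply: drift_bounded; exact: leq_addr.
have exit : {ae P, forall w, forall n, Z 0 w <= n%:R -> exists j, A n (n + j)%N w}.
  apply: ae_foralln => n.
  pose B := \bigcap_j ([set w | Z 0 w <= n%:R] `\` A n (n + j)%N).
  have mB : measurable B by apply: bigcapT_measurable => j; exact: exit_measurable.
  suff PB : P B = 0%E.
    exists B; split => // w /= /not_implyP[Ew nA] j _; split => // AA.
    by apply: nA; exists j.
  have PBfin : P B \is a fin_num by exact: fin_num_measure.
  have PBle j : (n + j)%:R * fine (P B) <= n%:R.
    rewrite -lee_fin EFinM fineK//.
    apply: le_trans (exit_probability (leq_addr j n)).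
    rewrite lee_wpmul2l ?lee_fin//; apply: le_measure; rewrite ?inE//.
      exact: exit_measurable.
    exact: bigcap_inf.
  have PB0 : 0 <= fine (P B) by rewrite fine_ge0.
  rewrite -[P B]fineK//; congr EFin; apply/eqP; rewrite eq_le PB0 andbT leNgt.
  apply/negP => PBpos.
  have := PBle (Num.truncn (n%:R / fine (P B))).+1; apply/negP; rewrite -ltNge.
  rewrite -ltr_pdivrMr// natrD; apply: (lt_le_trans (truncnS_gt _)).
  by rewrite lerDr.
move: drift exit; apply: filterS2 => w drift exit.
pose n := (Num.truncn (Z 0 w)).+1.
have [|j Aw] := exit n.
  exact: ltW (truncnS_gt _).
split; last exact: drift Aw.
by exists (n + j)%:R => k; have [_] := Aw k Logic.I; exact.
Qed.

End Supermartingale.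

(** * Stepsize series along a linearly growing count *)

Section Deterministic.
Context {R : realType}.

(** The series of [(k + 1) ^ (- 3 / 2)], compared with the telescoping differences
    of [4 / sqrt (k + 1)]. *)
Lemma sum_sqrt_inv_sqr n :
  \sum_(k < n) (Num.sqrt k.+1%:R / k.+1%:R ^+ 2 : R) <= 4.
Proof.
suff : \sum_(k < n) (Num.sqrt k.+1%:R / k.+1%:R ^+ 2 : R) <=
    4 - 4 / Num.sqrt n.+1%:R.
  by move/le_trans; apply; rewrite gerBl divr_ge0// sqrtr_ge0.
elim: n => [|n IH]; first by rewrite big_ord0 sqrtr1; lra.
rewrite big_ord_recr/=; move: IH; set s : R := Num.sqrt n.+1%:R; set u : R := Num.sqrt n.+2%:R => IH.
have s2 : s ^+ 2 = n.+1%:R by rewrite sqr_sqrtr// ler0n.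
have u2 : u ^+ 2 = s ^+ 2 + 1 by rewrite s2 natr1 sqr_sqrtr// ler0n.
have s1 : 1 <= s by rewrite -sqrtr1 ler_wsqrtr// ler1n.
have us : s <= u by rewrite ler_wsqrtr// ler_nat.
have u2s : u <= 2 * s by nra.
have [s0 u0 us0] : [/\ 0 < s, 0 < u & 0 < u + s] by split; lra.
have key : s / (s ^+ 2) ^+ 2 <= 4 / s - 4 / u.
  have uus : u * (u + s) <= 4 * s ^+ 2 by nra.
  have dif : (u - s) * (u + s) = 1 by rewrite -subr_sqr u2; ring.
  have -> : s / (s ^+ 2) ^+ 2 = (s ^+ 3)^-1 by field; rewrite gt_eqF.
  have -> : 4 / s - 4 / u = 4 * s ^+ 2 / (u * (u + s)) * (s ^+ 3)^-1.
    transitivity (4 * ((u - s) * (u + s)) * s ^+ 2 / (u * (u + s)) * (s ^+ 3)^-1).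
      by field; rewrite !gt_eqF.
    by rewrite dif mulr1.
  rewrite ler_peMl//; first by rewrite invr_ge0 exprn_ge0// ltW.
  by rewrite ler_pdivlMr ?mul1r// mulr_gt0.
rewrite s2 in key; apply: (le_trans (lerD IH key)).
by rewrite addrA subrK.
Qed.

(** The index [K] is one whose partial sum is within [e] of the supremum. *)
Lemma bounded_sum_tail (a : nat -> R) (M e : R) : 0 < e ->
  (forall k, 0 <= a k) -> (forall n, \sum_(k < n) a k <= M) ->
  exists K, forall m n, (K <= m)%N -> (m <= n)%N -> \sum_(m <= k < n) a k < e.
Proof.
move=> e0 a0 aM.
pose S n := \sum_(0 <= k < n) a k.
have SM n : S n <= M by rewrite /S big_mkord.
have hs : has_sup (range S).
  by split; [exists (S 0%N), 0%N|exists M => _ [n _ <-]].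
have [_ [K _ <-] SK] := sup_adherent e0 hs.
exists K => m n Km mn.
have Sn : S n <= sup (range S) by apply: sup_upper_bound => //; exists n.
have SKm : S K <= S m.
  rewrite /S (@big_cat_nat _ _ _ K 0%N m)//= lerDl; exact: sumr_ge0.
have : S n = S m + \sum_(m <= k < n) a k by rewrite /S (@big_cat_nat _ _ _ m 0%N n).
lra.
Qed.

(** A nondecreasing [t] staying below [p * m / 2] at time [2 * m] lags behind
    the line of slope [p] by at least [p * m / 2] throughout the block
    [m, 2 * m), which contributes at least [p / 8] to the series; this can
    happen for finitely many [m] only. *)
Lemma linear_growth (t : nat -> R) (p M : R) : 0 < p <= 1 ->
  0 <= t 0%N -> (forall k, t k <= t k.+1) ->
  (forall n, \sum_(k < n) `|t k - k%:R * p| / k.+1%:R ^+ 2 <= M) ->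
  exists K, forall k, (K <= k)%N -> p / 4 * k.+1%:R <= t k + 1.
Proof.
move=> /andP[p0 p1] t0 tS tM.
have tle j k : (j <= k)%N -> t j <= t k.
  by move=> jk; apply: (homo_leq (@lexx _ R) (@le_trans _ R)).
have p8 : 0 < p / 8 by lra.
have [|K KP] := @bounded_sum_tail (fun k => `|t k - k%:R * p| / k.+1%:R ^+ 2) M _ p8 _ tM.
  by move=> k; rewrite divr_ge0// exprn_ge0.
have dbl m : (K < m)%N -> p * m%:R / 2 <= t m.*2.
  move=> Km; have m0 : 0 < m%:R :> R by rewrite ltr0n (leq_ltn_trans _ Km).
  rewrite leNgt; apply/negP => tm.
  have := KP m m.*2 (ltnW Km); rewrite -addnn leq_addr => /(_ isT).
  apply/negP; rewrite -leNgt.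
  apply: (@le_trans _ _ (\sum_(m <= k < m + m) p / (8 * m%:R))).
    rewrite sumr_const_nat addnK -[leRHS]mulr_natr.
    by rewrite le_eqVlt; apply/orP; left; apply/eqP; field; rewrite gt_eqF.
  rewrite big_nat_cond [leRHS]big_nat_cond; apply: ler_sum => j /andP[/andP[mj jm] _].
  have tj : t j <= t m.*2 by apply: tle; rewrite -addnn ltnW.
  have mjR : m%:R <= j%:R :> R by rewrite ler_nat.
  have jmR : j.+1%:R <= 2 * m%:R :> R by rewrite -natrM ler_nat mul2n -addnn.
  have j0 : 0 < j.+1%:R :> R by rewrite ltr0n.
  rewrite ler_pdivlMr ?exprn_gt0// mulrAC ler_pdivrMr ?mulr_gt0//.
  rewrite distrC; apply: (@le_trans _ _ ((p * m%:R / 2) * (8 * m%:R))); last first.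
    rewrite ler_pM2r ?mulr_gt0//; apply: le_trans (ler_norm _).
    have : p * m%:R <= j%:R * p by rewrite mulrC ler_pM2r.
    lra.
  have -> : p * m%:R / 2 * (8 * m%:R) = p * (2 * m%:R) ^+ 2 by field.
  rewrite ler_pM2l//; apply: lerXn2r => //; rewrite nnegrE; first exact: ltW.
  by rewrite mulr_ge0// ltW.
(* [k] is compared with the even number [2 * (k / 2)], to which [dbl] applies. *)
exists K.*2.+2 => k Kk.
have km : (K < k./2)%N by rewrite -(doubleK K) -[(_.*2)./2.+1]/(_.*2.+2)./2 half_leq.
have kd : (k./2.*2 <= k)%N by rewrite -{2}(odd_double_half k) leq_addl.
have k2 : (k.+1 <= k./2.*2 + 2)%N.
  by rewrite -{1}(odd_double_half k) -addSn addnC leq_add2l; case: (odd k).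
have h1 := dbl _ km; have h2 := tle _ _ kd.
have : k.+1%:R <= 2 * (k./2)%:R + 2 :> R.
  by rewrite -natrM -natrD ler_nat mul2n.
nra.
Qed.

Lemma sum_indicators_le K n : (\sum_(k < n) (k < K)%N <= K)%N.
Proof.
suff [] : (\sum_(k < n) (k < K) <= n /\ \sum_(k < n) (k < K) <= K)%N by [].
elim: n => [|n [IH1 IH2]]; first by rewrite big_ord0.
rewrite big_ord_recr/=; have [nK|Kn] := ltnP n K.
  by rewrite addn1 ltnS IH1 (leq_trans _ nK).
by rewrite addn0 leqW.
Qed.

(** Once [t k + 1] is at least [p / 4 * (k + 1)], both terms are at most a constant
    times the corresponding deviation plus [(k + 1) ^ (- 3 / 2)]; the finitely many
    earlier indices contribute at most two each. *)
Lemma stepsize_sums (t : nat -> R) (p M : R) : 0 < p <= 1 ->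
  0 <= t 0%N -> (forall k, t k <= t k.+1) ->
  (forall n, \sum_(k < n) `|t k - k%:R * p| / k.+1%:R ^+ 2 <= M) ->
  exists C : R, forall n,
    \sum_(k < n) (`|p / (t k + 1) - k.+1%:R^-1| + (t k + 1)^-1 ^+ 2) <= C.
Proof.
move=> /[dup] p01 /andP[p0 p1] t0 tS tM.
have [K KP] := linear_growth p01 t0 tS tM.
have tge0 k : 0 <= t k.
  by elim: k => // k /le_trans; apply; exact: tS.
pose c := p / 4; have c0 : 0 < c by rewrite divr_gt0.
pose r k : R := Num.sqrt k.+1%:R / k.+1%:R ^+ 2.
pose q k : R := `|t k - k%:R * p| / k.+1%:R ^+ 2.
have q0 k : 0 <= q k by rewrite divr_ge0// exprn_ge0.
have r0 k : 0 <= r k by rewrite divr_ge0 ?sqrtr_ge0// exprn_ge0.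
have rinv k : k.+1%:R^-1 ^+ 2 <= r k.
  rewrite exprVn /r ler_peMl ?invr_ge0 ?exprn_ge0//.
  by rewrite -[leLHS]sqrtr1 ler_wsqrtr// ler1n.
(* [b] pays for the indices preceding the linear regime. *)
pose b k : R := (k < K)%N%:R * 2.
have term k : `|p / (t k + 1) - k.+1%:R^-1| + (t k + 1)^-1 ^+ 2 <=
    b k + (c^-1 * (q k + r k) + c^-1 ^+ 2 * r k).
  have tk := tge0 k; have k0 : 0 < k.+1%:R :> R by rewrite ltr0n.
  have t1 : 0 < t k + 1 by lra.
  have tinv : (t k + 1)^-1 <= 1 by rewrite invf_le1//; lra.
  have ti0 : 0 < (t k + 1)^-1 by rewrite invr_gt0.
  have [kK|Kk] := ltnP k K.
    rewrite /b kK mul1r; apply: ler_wpDr.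
      by rewrite addr_ge0// mulr_ge0 ?exprn_ge0 ?invr_ge0 ?addr_ge0// ltW.
    have ki : 0 <= (k.+1%:R^-1 : R) <= 1.
      by rewrite invr_ge0 ler0n invf_le1// ler1n.
    have : `|p / (t k + 1) - k.+1%:R^-1| <= 1.
      move/andP: ki => [ki0 ki1].
      have : 0 <= p / (t k + 1) <= 1.
        by rewrite mulr_ge0 ?mulr_ile1// ltW.
      move: ki0 ki1; move: (p / _) (_.+1%:R^-1) => x y y0 y1 /andP[x0 x1].
      by rewrite ler_norml; apply/andP; split; lra.
    have : (t k + 1)^-1 ^+ 2 <= 1 by rewrite expr_le1// ltW.
    lra.
  rewrite /b ltnNge Kk/= mul0r add0r.
  have tinvc : (t k + 1)^-1 <= c^-1 * k.+1%:R^-1.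
    by rewrite -invfM lef_pV2 ?posrE ?mulr_gt0//; exact: KP.
  have kiv : 0 < k.+1%:R^-1 :> R by rewrite invr_gt0.
  have civ : 0 < c^-1 by rewrite invr_gt0.
  apply: lerD; last first.
    apply: (@le_trans _ _ ((c^-1 * k.+1%:R^-1) ^+ 2)).
      by apply: lerXn2r => //; rewrite nnegrE ltW// mulr_gt0.
    by rewrite exprMn ler_wpM2l// exprn_ge0// ltW.
  have -> : p / (t k + 1) - k.+1%:R^-1 =
     ((k%:R * p - t k) + (p - 1)) * k.+1%:R^-1 * (t k + 1)^-1.
    by rewrite -natr1; field; rewrite !gt_eqF//; rewrite natr1.
  rewrite normrM (gtr0_norm ti0) normrM (gtr0_norm kiv).
  apply: (@le_trans _ _ ((`|t k - k%:R * p| + 1) * k.+1%:R^-1 * (c^-1 * k.+1%:R^-1))).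
    apply: ler_pM => //.
      by rewrite ltW.
    rewrite ler_pM2r//; apply: le_trans (ler_normD _ _) _.
    by rewrite distrC lerD2l ler_norml; apply/andP; split; lra.
  have -> : (`|t k - k%:R * p| + 1) * k.+1%:R^-1 * (c^-1 * k.+1%:R^-1) =
      c^-1 * (q k + k.+1%:R^-1 ^+ 2).
    by rewrite /q exprVn; field; rewrite !gt_eqF//; rewrite addrC natr1.
  by rewrite ler_pM2l// lerD2l.
exists (K%:R * 2 + (c^-1 * (M + 4) + c^-1 ^+ 2 * 4)) => n.
apply: (@le_trans _ _ (\sum_(k < n) (b k + (c^-1 * (q k + r k) + c^-1 ^+ 2 * r k)))).
  by apply: ler_sum => k _; exact: term.
rewrite !big_split/= -!mulr_sumr big_split/=.
have rs := sum_sqrt_inv_sqr n.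
have civ : 0 < c^-1 by rewrite invr_gt0.
apply: lerD.
  rewrite -mulr_suml ler_pM2r// -natr_sum ler_nat.
  by rewrite sum_indicators_le.
apply: lerD.
  by rewrite ler_pM2l//; apply: lerD => //; exact: tM.
by rewrite ler_pM2l ?exprn_gt0.
Qed.
End Deterministic.

(** * Counting independent draws *)

Section Counts.
Context {d : measure_display} {T : measurableType d} {R : realType}.
Variable P : probability T R.
Variables (G : nat -> set (set T)) (B : nat -> set T) (p : R).
Hypotheses (sub : forall k, <<s G k >> `<=` measurable)
  (mono : forall k, <<s G k >> `<=` <<s G k.+1 >>)
  (sB : forall k, <<s G k.+1 >> (B k)) (p01 : 0 < p <= 1)
  (indep : forall k A, <<s G k >> A -> P (A `&` B k) = (P A * p%:E)%E).

Definition count k w : R := \sum_(t < k) \1_(B t) w.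

Lemma countS k w : count k.+1 w = count k w + \1_(B k) w.
Proof. by rewrite /count big_ord_recr. Qed.

Let mono_le j k : (j <= k)%N -> <<s G j >> `<=` <<s G k >>.
Proof.
move=> /subnK <-; elim: (k - j)%N => // i IH A /IH; rewrite addSn; exact: mono.
Qed.

Lemma count_adapted k : adapted (G k) (count k).
Proof.
rewrite /adapted /count.
rewrite (_ : (fun w => _) = fun w => \sum_(t <- index_enum 'I_k) \1_(B t) w)//.
apply: (@measurable_sum _ (g_sigma_algebraType (G k)) _ setT _ _
  (fun t : 'I_k => (\1_(B t) : T -> R))) => t.
apply: (@measurable_indic _ (g_sigma_algebraType (G k))).
exact: (@mono_le t.+1 k (ltn_ord t) _ (@sB t)).
Qed.

Lemma count_bounds k w : 0 <= count k w <= k%:R.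
Proof.
elim: k => [|k IH]; first by rewrite /count big_ord0 !lexx.
rewrite countS indicE -natr1; case/andP: IH => h1 h2.
by case: (w \in B k) => /=; lra.
Qed.

Let mB k : measurable (B k). Proof. exact: (@sub k.+1). Qed.

Lemma indicator_orthogonal k h M : adapted (G k) h -> (forall w, `|h w| <= M) ->
  \int[P]_w (h w * (\1_(B k) w - p)) = 0.
Proof.
have iB : integrable_rv P (\1_(B k)).
  apply: (@summable_bounded _ _ _ _ _ 1); first exact: measurable_indic.
  by move=> w; rewrite indicE; case: (_ \in _); rewrite ?normr0 ?normr1.
have ip : integrable_rv P (cst p).
  by apply: (@summable_bounded _ _ _ _ _ `|p|) => // w.
move=> ah hM; apply: (expect_orthogonal (@sub k) ah hM); first exact: integrable_rvB.
move=> A sA; have mA := sub sA.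
have -> : (\int[P]_(w in A) (\1_(B k) w - p)%:E =
    \int[P]_(w in A) (\1_(B k) w)%:E - \int[P]_(w in A) p%:E)%E.
  rewrite -integralB_EFin//; first exact: integrableS iB.
  exact: integrableS ip.
have -> : (\int[P]_(w in A) (\1_(B k) w)%:E = P A * p%:E)%E.
  by rewrite integral_indic// (setIC (B k)); exact: indep.
rewrite integral_cst// muleC subee//.
by rewrite fin_numM// fin_num_measure.
Qed.

Let dev k w := count k w - k%:R * p.

Let dev_adapted k : adapted (G k) (dev k).
Proof.
apply: (@measurable_funB _ (g_sigma_algebraType (G k))); first exact: count_adapted.
exact: measurable_cst.
Qed.

Let dev_bounded k w : `|dev k w| <= k%:R.
Proof.
have /andP[c1 c2] := count_bounds k w; have [p0 p1] := andP p01.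
have k0 : 0 <= k%:R :> R by [].
rewrite /dev ler_norml; apply/andP; split; nra.
Qed.

Let mdev k : measurable_fun setT (dev k).
Proof. exact: adapted_measurable (@sub k) (@dev_adapted k). Qed.

(** The centered count is a sum of orthogonal terms bounded by one. *)
Lemma count_second_moment k : \int[P]_w (dev k w ^+ 2) <= k%:R.
Proof.
have p0 := andP p01.
have i2 j : integrable_rv P (fun w => dev j w ^+ 2).
  apply: (@summable_bounded _ _ _ _ _ (j%:R ^+ 2)); first exact: measurable_funX.
  by move=> w; rewrite normrX lerXn2r// nnegrE.
have iB j : integrable_rv P (fun w => \1_(B j) w - p).
  apply: (@summable_bounded _ _ _ _ _ 2).
    by apply: measurable_funB => //; exact: measurable_indic.
  move=> w; rewrite indicE ler_norml.
  by case: (_ \in _) => /=; apply/andP; split; case: p0; lra.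
elim: k => [|k IH].
  under eq_Rintegral do rewrite /dev /count big_ord0 mul0r subr0 expr0n/=.
  by rewrite Rintegral_cst// mul0r.
have ix : integrable_rv P (fun w => dev k w * (\1_(B k) w - p)).
  by apply: (@integrable_rvM _ _ _ _ _ _ k%:R).
have iB2 : integrable_rv P (fun w => (\1_(B k) w - p) ^+ 2).
  apply: (@summable_bounded _ _ _ _ _ 1).
    by apply: measurable_funX; apply: measurable_funB => //; exact: measurable_indic.
  move=> w; rewrite normrX indicE expr_le1// ler_norml.
  by case: (_ \in _) => /=; apply/andP; split; case: p0; lra.
rewrite (_ : \int[P]_w _ = \int[P]_w
    ((dev k w ^+ 2 + 2 * (dev k w * (\1_(B k) w - p))) + (\1_(B k) w - p) ^+ 2)); last first.
  by apply: eq_Rintegral => w _; rewrite /dev countS -natr1; ring.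
rewrite RintegralD//; last by apply: integrable_rvD => //; exact: integrable_rvZ.
rewrite RintegralD//; last exact: integrable_rvZ.
rewrite RintegralZl// (indicator_orthogonal (@dev_adapted k) (@dev_bounded k)).
rewrite mulr0 addr0 -natr1; apply: lerD => //.
rewrite -[leRHS](expect_cst P).
apply: le_Rintegral => //.
  by apply: (@summable_bounded _ _ _ _ (cst 1) 1) => // w; rewrite normr1.
move=> w _; rewrite indicE.
by case: (_ \in _) => /=; case: p0; nra.
exact: i2.
Qed.

(** By the second moment bound the mean of the [k]-th deviation is at most
    [sqrt (k + 1)], so the expected series is dominated by that of
    [(k + 1) ^ (- 3 / 2)]. *)
Lemma count_deviation_summable :
  {ae P, forall w, exists M : R, forall n,
    \sum_(k < n) `|count k w - k%:R * p| / k.+1%:R ^+ 2 <= M}.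
Proof.
pose D k w := `|dev k w| / k.+1%:R ^+ 2.
have mD k : measurable_fun setT (D k).
  apply: measurable_funM => //; exact: measurableT_comp.
have D0 k w : 0 <= D k w by rewrite divr_ge0// exprn_ge0.
have := @ae_bounded_series _ _ _ P setT D 4 measurableT mD D0.
have mean_abs k : \int[P]_w `|dev k w| <= Num.sqrt k.+1%:R.
  set s := Num.sqrt _.
  have s0 : 0 < s by rewrite sqrtr_gt0 ltr0n.
  have i2 : integrable_rv P (fun w => dev k w ^+ 2).
    apply: (@summable_bounded _ _ _ _ _ (k%:R ^+ 2)); first exact: measurable_funX.
    by move=> w; rewrite normrX lerXn2r// nnegrE.
  have ia : integrable_rv P (fun w => `|dev k w|).
    apply: (@summable_bounded _ _ _ _ _ k%:R); first exact: measurableT_comp.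
    by move=> w; rewrite normr_id.
  have ic : integrable_rv P (cst (s / 2)).
    by apply: (@summable_bounded _ _ _ _ _ `|s / 2|) => // w.
  (* Inequality between means, balanced at the size [s] of the deviation. *)
  apply: (@le_trans _ _ (\int[P]_w ((2 * s)^-1 * dev k w ^+ 2 + s / 2))).
    apply: le_Rintegral => //; first by apply: integrable_rvD => //; exact: integrable_rvZ.
    move=> w _; rewrite -subr_ge0.
    rewrite (_ : _ - _ = (2 * s)^-1 * (`|dev k w| - s) ^+ 2).
      by rewrite mulr_ge0 ?sqr_ge0// invr_ge0 mulr_ge0 ?ltW.
    by rewrite -[dev k w ^+ 2]real_normK ?num_real//; field; rewrite gt_eqF.
  rewrite RintegralD//; last exact: integrable_rvZ.
  rewrite RintegralZl// expect_cst.
  have s2 : s ^+ 2 = k.+1%:R by rewrite sqr_sqrtr.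
  apply: (@le_trans _ _ ((2 * s)^-1 * s ^+ 2 + s / 2)).
    apply: lerD => //; rewrite ler_pM2l ?invr_gt0 ?mulr_gt0// s2.
    by apply: (le_trans (count_second_moment k)); rewrite ler_nat.
  by rewrite le_eqVlt; apply/orP; left; apply/eqP; field; rewrite gt_eqF.
have main K : (\sum_(k < K) \int[P]_w (D k w)%:E <= 4%:E)%E.
  apply: (@le_trans _ _ (\sum_(k < K) (Num.sqrt k.+1%:R / k.+1%:R ^+ 2)%:E)%E); last first.
    by rewrite sumEFin lee_fin sum_sqrt_inv_sqr.
  apply: lee_sum => k _.
  have ia : integrable_rv P (fun w => `|dev k w|).
    apply: (@summable_bounded _ _ _ _ _ k%:R); first exact: measurableT_comp.
    by move=> w; rewrite normr_id.
  rewrite -EFin_expect.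
    by rewrite lee_fin RintegralZr// ler_pM2r ?invr_gt0 ?exprn_gt0.
  rewrite (_ : D k = fun w => (k.+1%:R ^+ 2)^-1 * `|dev k w|); first exact: integrable_rvZ.
  by apply/funext => w; rewrite mulrC.
move=> /(_ main); apply: filterS => w /(_ Logic.I); exact.
Qed.

(** What the random stepsizes owe to the law of large numbers: in the mean they
    behave like the deterministic stepsizes [1 / (k + 1)], up to summable errors.
    A mere [count / k --> p] would not give summability, hence the second
    moments. *)
Lemma stepsize_sums_ae :
  {ae P, forall w, exists C : R, forall n,
    \sum_(k < n) (`|p / (count k w + 1) - k.+1%:R^-1| +
                  (count k w + 1)^-1 ^+ 2) <= C}.
Proof.
apply: filterS count_deviation_summable => w [M wM].
apply: (@stepsize_sums _ (count ^~ w) p M p01) => //.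
  by have /andP[] := count_bounds 0 w.
by move=> k; rewrite countS lerDl indicE.
Qed.

End Counts.

(** * Variational inequalities and blocks of a profile *)

Lemma within_continuous_seq (R : realType) (p q : nat) (D : set 'rV[R]_p)
    (F : 'rV[R]_p -> 'rV[R]_q) (y : nat -> 'rV[R]_p) (a : 'rV[R]_p) :
  {within D, continuous F} -> D a -> (forall n, D (y n)) ->
  y n @[n --> \oo] --> a -> F (y n) @[n --> \oo] --> F a.
Proof.
move=> cF Da Dy ya W WFa.
have /(_ W WFa) := (@subspace_continuousP _ D _ F).1 cF a Da.
move=> near_a.
have near_n : \forall n \near \oo, D (y n) -> W (F (y n)) := ya _ near_a.
suff : \forall n \near \oo, W (F (y n)) by [].
by apply: filterS near_n => n; apply; exact: Dy.
Qed.

Lemma cvg_dot (R : realType) (p : nat) (u v : nat -> 'rV[R]_p) (a b : 'rV[R]_p) :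
  u n @[n --> \oo] --> a -> v n @[n --> \oo] --> b ->
  dot (u n) (v n) @[n --> \oo] --> dot a b.
Proof.
move=> ua vb; rewrite /dot.
suff h (j : 'I_p) : u n 0 j * v n 0 j @[n --> \oo] --> a 0 j * b 0 j.
  have := @cvg_big R 'I_p +%R 0 xpredT (@add_continuous R) nat \oo (index_enum _)
    (fun j n => u n 0 j * v n 0 j) (fun j => a 0 j * b 0 j) _ (fun j _ => h j).
  exact.
have hu : u n 0 j @[n --> \oo] --> a 0 j := cvg_comp _ _ ua (@coord_continuous _ _ _ 0 j a).
have hv : v n 0 j @[n --> \oo] --> b 0 j := cvg_comp _ _ vb (@coord_continuous _ _ _ 0 j b).
exact: (cvgM hu hv).
Qed.

Section VariationalInequality.
Context {R : realType} {p : nat}.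
Variables (K : set 'rV[R]_p) (F : 'rV[R]_p -> 'rV[R]_p).
Hypotheses (convK : forall a b t, K a -> K b -> 0 <= t -> t <= 1 -> K (a + t *: (b - a)))
  (cF : {within K, continuous F}) (acute : acute_angle K F).

(** The acute angle inequality extends, as a large inequality, to the solutions
    of the variational inequality: on the open segment from [y] to [xs] it
    holds either by hypothesis or because the point is itself a solution tested
    against [y], and continuity brings it to [y]. *)
Lemma acute_angle_ge0 y xs : K y -> VI_sol K F xs -> 0 <= dot (y - xs) (F y).
Proof.
move=> Ky Sxs; have [Kxs _] := Sxs.
pose t n : R := n.+2%:R^-1.
have t0 n : 0 < t n by rewrite invr_gt0 ltr0n.
have t1 n : t n < 1 by rewrite invf_lt1 ?ltr0n// ltr1n.
pose z n := y + t n *: (xs - y).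
have Kz n : K (z n) by apply: convK => //; exact: ltW.
have zpos n : 0 <= dot (y - xs) (F (z n)).
  have [Sz|nSz] := pselect (VI_sol K F (z n)).
    have := Sz.2 y Ky; rewrite /z opprD addrA subrr sub0r -scalerN opprB dotZr.
    by rewrite pmulr_rge0// dotC.
  have := acute (conj (Kz n) nSz) Sxs.
  rewrite /z (_ : _ - xs = (1 - t n) *: (y - xs)).
    by rewrite dotZl pmulr_rgt0 ?subr_gt0// => /ltW.
  apply/rowP => j; rewrite !mxE; ring.
have tc : t n @[n --> \oo] --> (0 : R).
  have := @cvg_harmonic R; rewrite -(cvg_shiftS (@harmonic R)).
  exact.
have zc : z n @[n --> \oo] --> y.
  rewrite -[X in _ --> X]addr0 -(scale0r (xs - y)).
  by apply: cvgD; [exact: cvg_cst|apply: cvgZr_tmp].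
have Fc := within_continuous_seq cF Ky Kz zc.
have c : dot (y - xs) (F (z n)) @[n --> \oo] --> dot (y - xs) (F y).
  exact: (cvg_dot (cvg_cst _) Fc).
rewrite -(cvg_lim _ c)//; apply: limr_ge; last exact: nearW.
by apply/cvg_ex; eexists; exact: c.
Qed.

End VariationalInequality.

Section Blocks.
Context {R : realType} {N m : nat} (G : game R N m).
Local Notation prof := 'rV[R]_(\sum_(i < N) ndim G i).
Implicit Types (u v : prof).

Lemma dot_blk u v : dot u v = \sum_(i < N) dot (blk u i) (blk v i).
Proof.
have dotM q (a b : 'rV[R]_q) : dot a b = (a *m b^T) 0 0.
  by rewrite mxE; apply: eq_bigr => j _; rewrite mxE.
rewrite dotM -{1}[u]submxrowK -{1}[v]submxrowK tr_mxrow mul_mxrow_mxcol.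
by rewrite summxE; apply: eq_bigr => i _; rewrite dotM.
Qed.

Lemma blkB u v i : blk (u - v) i = blk u i - blk v i.
Proof. exact: submxrowB. Qed.

Lemma blkZ a u i : blk (a *: u) i = a *: blk u i.
Proof. by apply/rowP => j; rewrite !mxE. Qed.

Lemma blkD u v i : blk (u + v) i = blk u i + blk v i.
Proof. exact: submxrowD. Qed.

Lemma blk_at_blk i (y : 'rV[R]_(ndim G i)) :
  blk (at_blk y) i = y.
Proof. by rewrite /blk /at_blk /upd mxrowK dfwithin. Qed.

Lemma blk_at_blk_neq i (y : 'rV[R]_(ndim G i)) j : i != j ->
  blk (at_blk y) j = 0.
Proof. by move=> ij; rewrite /blk /at_blk /upd mxrowK dfwithout// /blk submxrow0. Qed.

Lemma blk_upd u i (y : 'rV[R]_(ndim G i)) : blk (upd u y) i = y.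
Proof. by rewrite /blk /upd mxrowK dfwithin. Qed.

Lemma blk_upd_neq u i (y : 'rV[R]_(ndim G i)) j : i != j ->
  blk (upd u y) j = blk u j.
Proof. by move=> ij; rewrite /blk /upd mxrowK dfwithout. Qed.

Lemma dot_at_blk u i (y : 'rV[R]_(ndim G i)) : dot u (at_blk y) = dot (blk u i) y.
Proof.
rewrite dot_blk (bigD1 i)//= blk_at_blk// big1 ?addr0// => j ji.
by rewrite blk_at_blk_neq 1?eq_sym// /dot big1// => l _; rewrite [X in _ * X]mxE mulr0.
Qed.

Lemma coord_blk (j : 'I_(\sum_(i < N) ndim G i)) : exists i l, forall v, v 0 j = blk v i 0 l.
Proof.
exists (tagnat.sig1 j), (tagnat.sig2 j) => v.
by rewrite /blk mxE tagnat.sig2K.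
Qed.

Lemma blk_coord i l : exists j, forall u, blk u i 0 l = u 0 j.
Proof. by exists (tagnat.Rank i l) => u; rewrite /blk mxE. Qed.

Lemma closed_feasible :
  (forall i, closed (strat G i)) -> closed (feasible G).
Proof.
move=> clX; rewrite (_ : feasible G = \bigcap_i (fun u : prof => blk u i) @^-1` strat G i).
  apply: closed_bigI => i _; apply: closed_comp => // u _.
  have : continuous (fun u : prof => blk u i) ; last exact.
  move=> v B /(nbhs_ballP (blk v i))[e e0 eB].
  apply/nbhs_ballP; exists e => //= v' [_ vv']; apply: eB; split => // k l.
  by have [j jE] := blk_coord l; rewrite ord1 !jE; exact: vv'.
by apply/seteqP; split => [u fu i _|u fu i]; [exact: fu|exact: fu i Logic.I].
Qed.

Lemma convex_feasible a b t : (forall i, convex_set (strat G i)) ->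
  feasible G a -> feasible G b -> 0 <= t -> t <= 1 ->
  feasible G (a + t *: (b - a)).
Proof.
move=> convX fa fb t0 t1 i; rewrite blkD blkZ blkB.
exact: convex_segment (convX i) (fa i) (fb i) t0 t1.
Qed.

End Blocks.

(** * The history of the scheme *)

Section Filtration.
Context {R : realType} {d : measure_display} {T : measurableType d}
  {P : probability T R} {N m : nat} {xi : T -> 'rV[R]_m} {G : game R N m}
  {p : 'I_N -> R} {sel : nat -> T -> 'I_N} {smp : nat -> T -> 'rV[R]_m}
  {x : nat -> T -> 'rV[R]_(\sum_(i < N) ndim G i)}.
Hypotheses (sagr : SAGR P xi sel smp x p)
  (convX : forall i, convex_set (strat G i)) (clX : forall i, closed (strat G i)).

(** Generators of the history, named so that measurability for the history becomes
    measurability on the space generated by them. *)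
Definition history_gen k : set (set T) :=
  [set A | (exists2 B, borel_rV B & A = x 0%N @^-1` B) \/
    exists2 t, (t < k)%N &
      (exists i, A = [set w | sel t w = i]) \/
      (exists2 B, borel_rV B & A = sgrad sel smp x t @^-1` B)].

Definition half_gen k : set (set T) :=
  <<s history_gen k >> `|` [set A | exists i, A = [set w | sel k w = i]].

Local Notation H := history_gen.

Lemma history_measurable k : <<s H k >> `<=` measurable.
Proof.
apply: smallest_sub; first exact: sigma_algebra_measurable.
move=> _ [[B mB ->]|[t _ [[i ->]|[B mB ->]]]].
- exact: (init_rv sagr).
- exact: (sel_measurable sagr).
- exact: (sgrad_rv sagr).
Qed.

Lemma historyS k : <<s H k >> `<=` <<s H k.+1 >>.
Proof.
apply: sub_sigma_algebra2 => A [hA|[t tk hA]]; [by left|right].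
by exists t => //; exact: leqW.
Qed.

Lemma half_measurable k : <<s half_gen k >> `<=` measurable.
Proof.
apply: smallest_sub; first exact: sigma_algebra_measurable.
move=> A [/history_measurable//|[i ->]]; exact: (sel_measurable sagr).
Qed.

Lemma history_half_sub k : <<s H k >> `<=` <<s half_gen k >>.
Proof. by move=> A HA; apply: sub_sigma_algebra; left. Qed.

Definition draw k i : set T := [set w | sel k w = i].

Lemma draw_history k i : <<s H k.+1 >> (draw k i).
Proof.
by apply: sub_sigma_algebra; right; exists k => //; left; exists i.
Qed.

Lemma draw_half k i : <<s half_gen k >> (draw k i).
Proof. by apply: sub_sigma_algebra; right; exists i. Qed.

Lemma drawE k i w : (\1_(draw k i) w : R) = (sel k w == i)%:R.
Proof.
rewrite indicE; congr (_%:R); congr nat_of_bool.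
by apply/idP/idP => [/set_mem/= ->//|/eqP si]; exact/mem_set.
Qed.

Lemma sum_draw k w (c : 'I_N -> R) :
  \sum_i \1_(draw k i) w * c i = c (sel k w).
Proof.
rewrite (bigD1 (sel k w))//= drawE eqxx mul1r big1 ?addr0// => i ik.
by rewrite drawE eq_sym (negbTE ik) mul0r.
Qed.

Definition updates i k w : R := count (draw ^~ i) k w.

(** The stepsize that player [i] will use at iteration [k] if drawn; unlike the
    stepsize, it is known before the draw. *)
Definition gain i k w : R := (updates i k w + 1)^-1.

Lemma updates_ge0 i k w : 0 <= updates i k w.
Proof. by have /andP[] := @count_bounds _ _ R (draw ^~ i) k w. Qed.

Lemma stepsize_gain k w : stepsize sel k (sel k w) w = gain (sel k w) k w.
Proof.
rewrite /stepsize /gain /updates /count /nupdates big_ord_recr/= eqxx addn1/=.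
rewrite -natr1 natr_sum; congr (_ + 1)^-1.
by apply: eq_bigr => t _; rewrite drawE.
Qed.

Lemma gain_gt0 i k w : 0 < gain i k w.
Proof. by rewrite invr_gt0; have := updates_ge0 i k w; lra. Qed.

Lemma gain_le1 i k w : gain i k w <= 1.
Proof. by rewrite invf_le1; have := updates_ge0 i k w; lra. Qed.

Lemma gain_adapted i k : adapted (H k) (gain i k).
Proof.
apply: adaptedV => [w|]; first by have := updates_ge0 i k w; lra.
apply: adaptedD; last exact: adapted_cst.
by apply: count_adapted; [exact: historyS|move=> j; exact: draw_history].
Qed.

Lemma sgrad_adapted k j : adapted (H k.+1) (fun w => sgrad sel smp x k w 0 j).
Proof.
apply: (@coord_measurableP _ (g_sigma_algebraType (H k.+1))) => U oU.
apply: sub_sigma_algebra; right; exists k => //; right; exists U => //.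
exact: sub_sigma_algebra.
Qed.

Lemma iterate_feasible k w : feasible G (x k w).
Proof.
elim: k => [|k IH] i; first exact: (init_feasible sagr).
have [->|ni] := eqVneq i (sel k w); last by rewrite (step_other sagr).
rewrite (step_sel sagr).
by have [] := eprojP (@clX (sel k w)) (ex_intro _ _ (IH (sel k w))) (blk (x k w) (sel k w) -
    stepsize sel k (sel k w) w *: blk (sgrad sel smp x k w) (sel k w)).
Qed.

Lemma strat_neq0 i : strat G i !=set0.
Proof. by exists (blk (x 0%N point) i); exact: iterate_feasible. Qed.

Lemma step_active k w i : sel k w = i ->
  blk (x k.+1 w) i = eproj (strat G i)
    (blk (x k w) i - gain i k w *: blk (sgrad sel smp x k w) i).
Proof. by move=> <-; rewrite (step_sel sagr) stepsize_gain. Qed.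

(** By induction: the new iterate is the projection, a continuous map, of a point
    computed from the last iterate, the last sampled gradient and the gain. *)
Lemma iterate_adapted k j : adapted (H k) (fun w => x k w 0 j).
Proof.
elim: k j => [|k IH] j.
  apply: (@coord_measurableP _ (g_sigma_algebraType (H 0))) => U oU.
  by apply: sub_sigma_algebra; left; exists U => //; exact: sub_sigma_algebra.
have {}IH j' := adaptedS (@historyS k) (IH j').
have [i [l jE]] := coord_blk j.
pose V w := blk (x k w) i - gain i k w *: blk (sgrad sel smp x k w) i.
rewrite (_ : (fun w => _) = (fun w => \1_(draw k i) w * eproj (strat G i) (V w) 0 l +
   (1 - \1_(draw k i) w) * blk (x k w) i 0 l)); last first.
  apply/funext => w; rewrite jE drawE; have [si|ni] := eqVneq (sel k w) i.
    by rewrite (step_active si) mul1r subrr mul0r addr0.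
  by rewrite (step_other sagr) 1?eq_sym// mul0r add0r subr0 mul1r.
have api : adapted (H k.+1) (\1_(draw k i) : T -> R).
  by apply: adapted_indic; exact: draw_history.
have ablk l' : adapted (H k.+1) (fun w => blk (x k w) i 0 l').
  have [j' j'E] := blk_coord (G := G) l'.
  by rewrite (_ : (fun w => _) = fun w => x k w 0 j')//; apply/funext => w; rewrite j'E.
apply: adaptedD; apply: adaptedM => //; last first.
  by apply: adaptedB => //; exact: adapted_cst.
apply: (@coord_measurable_continuous _ (g_sigma_algebraType (H k.+1)) _ _ _ V).
  move=> l'.
  rewrite (_ : (fun w => _) = fun w => blk (x k w) i 0 l' -
    gain i k w * blk (sgrad sel smp x k w) i 0 l'); last first.
    by apply/funext => w; rewrite /V !mxE.
  apply: adaptedB => //; apply: adaptedM.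
    by apply: adaptedS (@gain_adapted i k); exact: historyS.
  have [j' j'E] := blk_coord (G := G) l'.
  rewrite (_ : (fun w => _) = fun w => sgrad sel smp x k w 0 j').
    exact: sgrad_adapted.
  by apply/funext => w; rewrite j'E.
apply: eproj_continuous; [exact: convX|exact: clX|exact: strat_neq0].
Qed.

(** Projecting onto the strategy set of the active player brings the iterate
    closer to every feasible profile, and the other blocks do not move. *)
Lemma step_distance xs k w : feasible G xs ->
  dot (x k.+1 w - xs) (x k.+1 w - xs) <=
  dot (x k w - stepsize sel k (sel k w) w *: sgrad sel smp x k w - xs)
      (x k w - stepsize sel k (sel k w) w *: sgrad sel smp x k w - xs).
Proof.
move=> fxs; rewrite !dot_blk; apply: ler_sum => i _.
rewrite !blkB blkZ; have [->|ni] := eqVneq i (sel k w).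
  rewrite (step_sel sagr); apply: eproj_closer; [exact: convX|exact: clX| |exact: fxs].
  exact: strat_neq0.
rewrite (step_other sagr)// [blk (sgrad _ _ _ _ _) i]blk_at_blk_neq 1?eq_sym//.
by rewrite scaler0 subr0.
Qed.

End Filtration.

(** * Solutions as limits along times of small drift *)

Section SmallDrift.
Context {R : realType} {p : nat}.
Variables (K : set 'rV[R]_p) (F : 'rV[R]_p -> 'rV[R]_p) (xs : 'rV[R]_p)
  (y : nat -> 'rV[R]_p) (M C : R).
Hypotheses (clK : closed K) (cF : {within K, continuous F})
  (acute : acute_angle K F) (Sxs : VI_sol K F xs) (Ky : forall n, K (y n))
  (yM : forall n, dot (y n - xs) (y n - xs) <= M).

Let u k := dot (y k - xs) (F (y k)).

Hypotheses (u0 : forall k, 0 <= u k)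
  (uC : forall n, \sum_(k < n) k.+1%:R^-1 * u k <= C).

(** The weights [1 / (k + 1)] have a divergent sum: were the drift at least [e]
    from some point on, each block [q, 2 * q) would contribute at least [e / 2]. *)
Lemma drift_small e n : 0 < e -> exists2 k, (n <= k)%N & u k < e.
Proof.
move=> e0; apply: contrapT => /forall2NP none.
have ue k : (n <= k)%N -> e <= u k.
  by move=> nk; case: (none k) => //; rewrite leNgt => /negP.
have [||L LP] := @bounded_sum_tail _ (fun k => k.+1%:R^-1 * u k) C (e / 2) _ _ uC.
- by rewrite divr_gt0.
- by move=> k; rewrite mulr_ge0.
pose q := (maxn L n).+1.
have := LP q q.*2 (leq_trans (leq_maxl _ _) (leqnSn _)).
rewrite -addnn leq_addr => /(_ isT); apply/negP; rewrite -leNgt.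
have q0 : 0 < q%:R :> R by rewrite ltr0n.
apply: (@le_trans _ _ (\sum_(q <= k < q + q) (2 * q%:R)^-1 * e)).
  rewrite sumr_const_nat addnK -mulr_natr le_eqVlt; apply/orP; left; apply/eqP.
  by field; rewrite gt_eqF.
rewrite big_nat_cond [leRHS]big_nat_cond; apply: ler_sum => k /andP[/andP[qk kq] _].
have k0 : 0 < k.+1%:R :> R by rewrite ltr0n.
apply: ler_pM; [by rewrite invr_ge0 mulr_ge0|exact: ltW| |].
  rewrite lef_pV2 ?posrE ?mulr_gt0// -natrM ler_nat mul2n -addnn; exact: kq.
by apply: ue; apply: leq_trans qk; rewrite /q leqW// leq_maxr.
Qed.

(** The drift is small infinitely often, and the process stays in a compact
    set: a cluster point of the times of small drift has zero drift, so the
    acute angle property makes it a solution. *)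
Lemma vi_subsequence : exists2 phi : nat -> nat,
  {homo phi : k l / (k < l)%N >-> (k < l)%N} &
  exists2 a, VI_sol K F a & y (phi k) @[k --> \oo] --> a.
Proof.
pose r n : R := n.+1%:R^-1.
have r0 n : 0 < r n by rewrite invr_gt0 ltr0n.
have rle j k : (j <= k)%N -> r k <= r j.
  by move=> jk; rewrite lef_pV2 ?posrE ?ltr0n// ler_nat.
have /choice[kappa kappaP] n : exists k, (n <= k)%N /\ u k < r n.
  by have [k] := drift_small n (r0 n); exists k.
pose Kc := K `&` [set v | dot (xs - v) (xs - v) <= M].
have cptKc : compact Kc.
  apply: bounded_closed_compact.
    have [B [Br HB]] := dot_bounded_set xs M.
    by exists B; split => // B' BB' v [_]; exact: HB.
  apply: closedI => //.
  rewrite (_ : [set v | _] = (fun v => dot (xs - v) (xs - v)) @^-1` [set s | s <= M])//.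
  by apply: closed_comp => [v _|]; [exact: dist2_continuous|exact: closed_le].
have Kcy n : Kc (y n).
  by split=> //=; rewrite -opprB dotNl dotNr opprK.
have [a [[Ka _] cla]] : Kc `&` cluster ((y \o kappa) @ \oo) !=set0.
  by apply: cptKc; exists 0%N => // n _; exact: Kcy.
have near_a n : exists k, [/\ (n <= k)%N, ball a (r n) (y k) & u k < r n].
  have [|v [[j nj <-] av]] := cla [set y (kappa j) | j in [set j | (n <= j)%N]] _ _
      (nbhsx_ballx a (r n) (r0 n)).
    by exists n => // j /= nj; exists j.
  have [k1 k2] := kappaP j; exists (kappa j); split => //.
    exact: leq_trans k1.
  exact: lt_le_trans (rle _ _ nj).
have [f fP] := choice near_a.
(* Each search restarts after the index found last. *)
pose phi := fix phi n := if n is n'.+1 then f (phi n').+1 else f 0%N.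
have phiS n : (phi n < phi n.+1)%N by have [] := fP (phi n).+1.
have phi_ge n : (n <= phi n)%N by elim: n => // n /leq_ltn_trans; apply.
have phiP n : ball a (r n) (y (phi n)) /\ u (phi n) < r n.
  case: n => [|n] /=; first by have [] := fP 0%N.
  have [_ h1 h2] := fP (phi n).+1.
  have nle : r (phi n).+1 <= r n.+1 by apply: rle; rewrite ltnS.
  by split; [exact: le_ball h1|exact: lt_le_trans nle].
have rc : r n @[n --> \oo] --> (0 : R) by exact: cvg_harmonic.
have yc : y (phi n) @[n --> \oo] --> a.
  move=> W /(nbhs_ballP a)[e e0 eW].
  have /cvgrPdist_lt/(_ e e0)[n0 _ n0P] := rc.
  exists n0 => // n /= nn; apply: eW; have [h _] := phiP n; apply: le_ball h.
  by have := n0P n nn; rewrite /= sub0r normrN gtr0_norm// => /ltW.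
exists phi; first exact: (homo_ltn ltn_trans phiS).
exists a => //; apply: contrapT => nSa.
have := acute (conj Ka nSa) Sxs; apply/negP; rewrite -leNgt.
have Fc := within_continuous_seq cF Ka (fun n => Ky (phi n)) yc.
have dc : dot (y (phi n) - xs) (F (y (phi n))) @[n --> \oo] --> dot (a - xs) (F a).
  by apply: cvg_dot => //; apply: cvgB => //; exact: cvg_cst.
apply: (ler_cvg_to dc rc); apply: nearW => n.
by have [_ /ltW] := phiP n.
Qed.

End SmallDrift.

(** Test the variational inequality against the profile in which only player [i]
    deviates. *)
Lemma VI_sol_QNE (R : realType) (d : measure_display) (T : measurableType d)
    (P : probability T R) (N m : nat) (xi : T -> 'rV[R]_m) (G : game R N m) a :
  VI_sol (feasible G) (grad_map P G xi) a -> QNE P G xi a.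
Proof.
move=> [fa Sa]; split=> // i v Xv.
have := Sa (upd a v).
have fv : feasible G (upd a v).
  move=> j; have [<-|ij] := eqVneq i j; first by rewrite blk_upd.
  by rewrite blk_upd_neq.
move=> /(_ fv); rewrite dot_blk (bigD1 i)//= [X in _ + X]big1 ?addr0.
  by rewrite blkB blk_upd [blk (grad_map _ _ _ _) i]mxrowK.
move=> j ji; rewrite blkB blk_upd_neq 1?eq_sym// subrr.
by rewrite /dot big1// => l _; rewrite [X in _ * X]mxE mulr0.
Qed.

(** * One step of the scheme *)

Section OneStep.
Context {R : realType} {d : measure_display} {T : measurableType d}
  {P : probability T R} {N m : nat} {xi : T -> 'rV[R]_m} {G : game R N m}
  {p : 'I_N -> R} {sel : nat -> T -> 'I_N} {smp : nat -> T -> 'rV[R]_m}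
  {x : nat -> T -> 'rV[R]_(\sum_(i < N) ndim G i)}.
Hypotheses (sagr : SAGR P xi sel smp x p)
  (convX : forall i, convex_set (strat G i)) (clX : forall i, closed (strat G i))
  (cF : {within feasible G, continuous (grad_map P G xi)})
  (acute : acute_angle (feasible G) (grad_map P G xi))
  (asmC : assumptionC P xi sel smp x).
Variables (MF Mw : 'I_N -> R).
Hypotheses
  (MFP : forall i y, feasible G y -> enorm (pgrad i (mean_cost P xi i) y) <= MF i)
  (MwP : forall k, exists2 Y : T -> R,
    is_condexp P (history_half sel smp x k)
      (fun w => enorm (noise P xi sel smp x k w) ^+ 2) Y &
    {ae P, forall w, Y w <= Mw (sel k w) ^+ 2}).
Variable xs : 'rV[R]_(\sum_(i < N) ndim G i).
Hypothesis Sxs : VI_sol (feasible G) (grad_map P G xi) xs.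

Local Notation H := (@history_gen R d T N m G sel smp x).
Local Notation half := (@half_gen R d T N m G sel smp x).
Local Notation dr := (@draw d T N sel).
Local Notation g := (@gain R d T N sel).
Local Notation n k := (noise P xi sel smp x k).

Let fxs : feasible G xs. Proof. by case: Sxs. Qed.

Let feas k w : feasible G (x k w).
Proof. exact: (iterate_feasible sagr clX). Qed.

Let ax k j : adapted (H k) (fun w => x k w 0 j).
Proof. exact: (iterate_adapted sagr convX clX). Qed.

Let subH k : <<s H k >> `<=` measurable.
Proof. exact: (history_measurable sagr). Qed.

Let subhalf k : <<s half k >> `<=` measurable.
Proof. exact: (half_measurable sagr). Qed.

Lemma prob_bounds i : 0 < p i <= 1.
Proof.
rewrite (p_gt0 sagr)/= -(p_sum1 sagr) (bigD1 i)//= lerDl.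
by apply: sumr_ge0 => j _; exact: ltW (p_gt0 sagr j).
Qed.

Definition dev k w := x k w - xs.

Definition lyap k w : R := 1 + dot (dev k w) (dev k w).

Definition slope i k w : R :=
  dot (blk (dev k w) i) (pgrad i (mean_cost P xi i) (x k w)).

Definition drift k w : R := dot (dev k w) (grad_map P G xi (x k w)).

(** Bound on the relative growth of [lyap] at iteration [k]: the gap between the
    mean stepsizes and the deterministic stepsizes, and the second-order terms. *)
Definition growth k w : R :=
  \sum_i ((1 + MF i ^+ 2) * `|p i * g i k w - k.+1%:R^-1| +
          2 * (MF i ^+ 2 + Mw i ^+ 2) * (p i * g i k w ^+ 2)).

Definition cumul k w : R := \sum_(t < k) growth t w.

(** Dividing by the exponential of the accumulated growth turns the
    perturbed descent of [lyap] into a genuine supermartingale inequality. *)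
Definition potential k w : R := expR (- cumul k w) * lyap k w.

Definition descent k w : R :=
  expR (- cumul k.+1 w) * (2 * k.+1%:R^-1 * drift k w).

Lemma lyap_ge1 k w : 1 <= lyap k w.
Proof. by rewrite lerDl dot_ge0. Qed.

Lemma driftE k w : drift k w = \sum_i slope i k w.
Proof.
rewrite /drift dot_blk; apply: eq_bigr => i _.
by rewrite [blk (grad_map _ _ _ _) i]mxrowK.
Qed.

Lemma drift_ge0 k w : 0 <= drift k w.
Proof.
apply: (acute_angle_ge0 _ cF acute) => // a b t fa fb t0 t1.
exact: convex_feasible.
Qed.

Lemma growth_ge0 k w : 0 <= growth k w.
Proof.
apply: sumr_ge0 => i _; apply: addr_ge0; apply: mulr_ge0 => //.
- by rewrite addr_ge0// sqr_ge0.
- by rewrite mulr_ge0// addr_ge0// sqr_ge0.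
- by rewrite mulr_ge0 ?sqr_ge0// ltW// (p_gt0 sagr).
Qed.

Lemma cumul_ge0 k w : 0 <= cumul k w.
Proof. by apply: sumr_ge0 => t _; exact: growth_ge0. Qed.

Lemma slope_le i k w : `|slope i k w| <= (1 + MF i ^+ 2) / 2 * lyap k w.
Proof.
apply: (le_trans (dot_le_sum_sqr _ _)).
have h1 : dot (blk (dev k w) i) (blk (dev k w) i) <= lyap k w - 1.
  rewrite /lyap addrC addKr dot_blk (bigD1 i)//= lerDl.
  by apply: sumr_ge0 => j _; exact: dot_ge0.
have h2 : dot (pgrad i (mean_cost P xi i) (x k w)) (pgrad i (mean_cost P xi i) (x k w))
    <= MF i ^+ 2.
  rewrite -enorm_sqr lerXn2r ?nnegrE ?sqrtr_ge0//; last exact: MFP.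
  by apply: le_trans (MFP i (feas k w)); exact: sqrtr_ge0.
have h3 := lyap_ge1 k w; have h4 := sqr_ge0 (MF i); nra.
Qed.

Let dev_adapted k j : adapted (H k) (fun w => dev k w 0 j).
Proof.
rewrite (_ : (fun w => _) = fun w => x k w 0 j - xs 0 j).
  by apply: adaptedB => //; exact: adapted_cst.
by apply/funext => w; rewrite !mxE.
Qed.

Let gradmap_adapted k j : adapted (H k) (fun w => grad_map P G xi (x k w) 0 j).
Proof.
apply: (@measurable_continuous_within _ (g_sigma_algebraType (H k)) _ _ (x k)
  (feasible G) (fun y => grad_map P G xi y 0 j)) => //.
- by move=> j'; exact: ax.
- apply/subspace_continuousP => y Xy.
  have c := (@subspace_continuousP _ (feasible G) _ (grad_map P G xi)).1 cF y Xy.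
  exact: (cvg_comp _ _ c (@coord_continuous _ _ _ 0 j _)).
Qed.

Lemma lyap_adapted k : adapted (H k) (lyap k).
Proof.
apply: adaptedD; first exact: adapted_cst.
by apply: adapted_sum => j; exact: adaptedM.
Qed.

Lemma slope_adapted i k : adapted (H k) (slope i k).
Proof.
rewrite (_ : slope i k = fun w => \sum_l blk (dev k w) i 0 l *
    blk (grad_map P G xi (x k w)) i 0 l); last first.
  by apply/funext => w; rewrite /slope /dot [blk (grad_map _ _ _ _) i]mxrowK.
apply: adapted_sum => l; have [j jE] := blk_coord l.
rewrite (_ : (fun w => _) = fun w => dev k w 0 j * grad_map P G xi (x k w) 0 j).
  exact: adaptedM.
by apply/funext => w; rewrite !jE.
Qed.

Lemma drift_adapted k : adapted (H k) (drift k).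
Proof.
rewrite (_ : drift k = fun w => \sum_i slope i k w).
  by apply: adapted_sum => i; exact: slope_adapted.
by apply/funext => w; rewrite driftE.
Qed.

Let ga i k : adapted (H k) (g i k). Proof. exact: gain_adapted. Qed.

Lemma growth_adapted k : adapted (H k) (growth k).
Proof.
apply: adapted_sum => i; apply: adaptedD; apply: adaptedM; try exact: adapted_cst.
  apply: adapted_norm; apply: adaptedB; last exact: adapted_cst.
  by apply: adaptedM => //; exact: adapted_cst.
by apply: adaptedM; [exact: adapted_cst|exact: adaptedX].
Qed.

Let mono_le j k : (j <= k)%N -> <<s H j >> `<=` <<s H k >>.
Proof.
move=> /subnK <-; elim: (k - j)%N => // i IH A /IH; rewrite addSn; exact: historyS.
Qed.

(** [cumul k.+1] only involves the draws made before iteration [k]. *)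
Lemma cumul_predictable k : adapted (H k) (cumul k.+1).
Proof.
apply: adapted_sum => t; apply: adaptedS (@growth_adapted t).
by apply: mono_le; rewrite -ltnS.
Qed.

Lemma cumul_adapted k : adapted (H k) (cumul k).
Proof.
apply: adapted_sum => t; apply: adaptedS (@growth_adapted t).
by apply: mono_le; exact: ltnW.
Qed.

Let expN_adapted k (f : T -> R) : adapted (H k) f -> adapted (H k) (fun w => expR (- f w)).
Proof.
move=> af; apply: adapted_expR.
rewrite (_ : (fun w => _) = fun w => 0 - f w); last by apply/funext => w; rewrite sub0r.
by apply: adaptedB => //; exact: adapted_cst.
Qed.

Lemma potential_adapted k : adapted (H k) (potential k).
Proof.
by apply: adaptedM; [apply: expN_adapted; exact: cumul_adapted|exact: lyap_adapted].
Qed.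

Lemma descent_adapted k : adapted (H k) (descent k).
Proof.
apply: adaptedM; first by apply: expN_adapted; exact: cumul_predictable.
by apply: adaptedM; [exact: adapted_cst|exact: drift_adapted].
Qed.

Lemma potential_ge0 k w : 0 <= potential k w.
Proof.
by rewrite mulr_ge0 ?expR_ge0//; have := lyap_ge1 k w; lra.
Qed.

Lemma descent_ge0 k w : 0 <= descent k w.
Proof.
by rewrite mulr_ge0 ?expR_ge0// mulr_ge0 ?drift_ge0// mulr_ge0// invr_ge0.
Qed.

(** First-order and deterministic second-order terms of a step of player [i]. *)
Definition step_term i k w : R :=
  - 2 * g i k w * slope i k w + 2 * g i k w ^+ 2 * MF i ^+ 2.

Definition cur_gain k w : R := \sum_i \1_(dr k i) w * g i k w.

(** Pathwise descent: the indicators select the terms of the active player. *)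
Lemma lyap_step k w :
  lyap k.+1 w <= lyap k w + \sum_i \1_(dr k i) w * step_term i k w
    - 2 * cur_gain k w * dot (dev k w) (n k w)
    + 2 * cur_gain k w ^+ 2 * dot (n k w) (n k w).
Proof.
rewrite /cur_gain !sum_draw /step_term.
set i := sel k w; set gm := g i k w.
have := step_distance sagr convX clX k w fxs.
rewrite stepsize_gain -/i -/gm addrAC -/(dev k w) -/(dev k.+1 w) dot_subZ.
set F := pgrad i (mean_cost P xi i) (x k w).
have sE : sgrad sel smp x k w = at_blk F + n k w by rewrite /noise addrC subrK.
have := dotD_le (at_blk F) (n k w).
rewrite sE (dotDr _ _ (dev k w)) !dot_at_blk blk_at_blk -/F.
have -> : dot (blk (dev k w) i) F = slope i k w by [].
have F2 : dot F F <= MF i ^+ 2.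
  rewrite -enorm_sqr lerXn2r ?nnegrE ?sqrtr_ge0//; last exact: MFP.
  by apply: le_trans (MFP i (feas k w)); exact: sqrtr_ge0.
have gm2 := sqr_ge0 gm.
move: (dot (at_blk F + _) _) (dot (n k w) _) (dot (dev k w) (n k w)) => q nn dn.
rewrite /lyap; move: (dot (dev k.+1 w) _) (dot (dev k w) _) => a b qle able.
have : gm ^+ 2 * q <= gm ^+ 2 * (2 * MF i ^+ 2 + 2 * nn).
  by rewrite ler_wpM2l//; lra.
lra.
Qed.

(** Averaging over the player drawn, the mean stepsizes [p i * gain i] are replaced
    by [1 / (k + 1)]; the error is proportional to the slopes, which are bounded by
    a multiple of [lyap] because the gradients are bounded. *)
Lemma mean_step k w :
  lyap k w + \sum_i p i * (step_term i k w + 2 * g i k w ^+ 2 * Mw i ^+ 2) <=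
  expR (growth k w) * lyap k w - 2 * k.+1%:R^-1 * drift k w.
Proof.
apply: (@le_trans _ _ ((1 + growth k w) * lyap k w - 2 * k.+1%:R^-1 * drift k w)).
  rewrite mulrDl mul1r -[leRHS]addrA lerD2l /growth mulr_suml driftE mulr_sumr -sumrB.
  apply: ler_sum => i _; rewrite /step_term.
  have L1 := lyap_ge1 k w; have sl := slope_le i k w.
  have p0 := p_gt0 sagr i.
  have pg2 : 0 <= p i * g i k w ^+ 2 by rewrite mulr_ge0 ?sqr_ge0// ltW.
  have M2 : 0 <= MF i ^+ 2 + Mw i ^+ 2 by rewrite addr_ge0 ?sqr_ge0.
  have q1 : 2 * (MF i ^+ 2 + Mw i ^+ 2) * (p i * g i k w ^+ 2) <=
      2 * (MF i ^+ 2 + Mw i ^+ 2) * (p i * g i k w ^+ 2) * lyap k w.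
    by rewrite ler_peMr// mulr_ge0// mulr_ge0.
  have q2 : - (p i * g i k w - k.+1%:R^-1) * slope i k w <=
      `|p i * g i k w - k.+1%:R^-1| * ((1 + MF i ^+ 2) / 2 * lyap k w).
    apply: (le_trans (ler_norm _)); rewrite normrM normrN.
    by rewrite ler_wpM2l.
  move: q1 q2; set c : R := _.+1%:R^-1; set e : R := `|_| => q1 q2.
  lra.
rewrite lerD2r ler_wpM2r ?expR_ge1Dx//.
by have := lyap_ge1 k w; lra.
Qed.

Lemma growth_bounded : exists2 C : R, 0 <= C & forall k w, growth k w <= C.
Proof.
exists (\sum_i ((1 + MF i ^+ 2) + 2 * (MF i ^+ 2 + Mw i ^+ 2))) => [|k w].
  by apply: sumr_ge0 => i _; have := sqr_ge0 (MF i); have := sqr_ge0 (Mw i); lra.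
apply: ler_sum => i _.
have /andP[p0 p1] := prob_bounds i.
have g0 := @gain_gt0 R _ T _ sel i k w; have g1 := @gain_le1 R _ T _ sel i k w.
have [c0 c1] : 0 < (k.+1%:R^-1 : R) /\ (k.+1%:R^-1 : R) <= 1.
  by rewrite invr_gt0 ltr0n invf_le1// ler1n.
apply: lerD.
  rewrite ler_piMr ?addr_ge0 ?sqr_ge0// ler_norml.
  have pg : 0 <= p i * g i k w <= 1 by rewrite mulr_ge0 ?mulr_ile1// ltW.
  move: pg c0 c1; move: (p i * _) (_.+1%:R^-1) => a c /andP[a0 a1] c0 c1.
  by apply/andP; split; lra.
rewrite ler_piMr ?mulr_ge0 ?addr_ge0 ?sqr_ge0//.
by rewrite mulr_ile1 ?sqr_ge0 ?expr_le1// ltW.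
Qed.

Lemma cumul_bounded k : exists C : R, forall w, cumul k w <= C.
Proof.
have [C C0 gC] := growth_bounded; exists (k%:R * C) => w.
rewrite mulrC mulr_natr -[k in leRHS]card_ord -sumr_const.
by apply: ler_sum => t _; exact: gC.
Qed.

Section Supermartingale.
Variables (k : nat) (A : set T) (L : R).
Implicit Types (f : T -> R) (C : R).
Hypotheses (sA : <<s H k >> A) (LA : forall w, A w -> lyap k w <= L).

(* The weight restricts to the event [A] and normalizes the potential; since
   [cumul k.+1] only involves earlier draws, it is known before iteration [k]. *)
Let h w : R := \1_A w * expR (- cumul k.+1 w).

Let h0 w : 0 <= h w.
Proof. by rewrite mulr_ge0 ?expR_ge0. Qed.

Let ah : adapted (H k) h.
Proof.
apply: adaptedM; first exact: adapted_indic.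
by apply: expN_adapted; exact: cumul_predictable.
Qed.

Let h_bounded f C : (forall w, A w -> `|f w| <= C) ->
  forall w, `|h w * f w| <= `|C|.
Proof.
move=> fC w; rewrite /h indicE; case: (boolP (w \in A)) => [/set_mem Aw|_].
  rewrite mul1r normrM ger0_norm ?expR_ge0//.
  apply: (@le_trans _ _ `|f w|); last exact: le_trans (fC w Aw) (ler_norm C).
  by rewrite ler_piMl// expR_le1 oppr_le0 cumul_ge0.
by rewrite !mul0r normr0.
Qed.

Let toT f : adapted (H k) f -> measurable_fun setT f.
Proof. exact: adapted_measurable. Qed.

Let toThalf f : adapted (half k) f -> measurable_fun setT f.
Proof. exact: adapted_measurable. Qed.

Let summable_h f C : adapted (H k) f -> (forall w, A w -> `|f w| <= C) ->
  integrable_rv P (fun w => h w * f w).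
Proof.
move=> af fC; apply: (@summable_bounded _ _ _ _ _ `|C|); last exact: h_bounded.
by apply: toT; exact: adaptedM.
Qed.

Let lyap_norm w : A w -> `|lyap k w| <= L.
Proof. by move=> Aw; rewrite ger0_norm ?LA//; have := lyap_ge1 k w; lra. Qed.

Let step_bounded i w : A w ->
  `|step_term i k w| <= (1 + MF i ^+ 2) * L + 2 * MF i ^+ 2.
Proof.
move=> Aw; have g0 := @gain_gt0 R _ T _ sel i k w.
have g1 := @gain_le1 R _ T _ sel i k w.
have s1 := slope_le i k w; have l1 := LA Aw; have F2 := sqr_ge0 (MF i).
apply: (le_trans (ler_normD _ _)); apply: lerD.
  rewrite normrM normrM normrN (gtr0_norm g0) (ger0_norm (ler0n R 2)).
  apply: (@le_trans _ _ (2 * 1 * `|slope i k w|)).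
    by rewrite ler_wpM2r// ler_wpM2l.
  have : (1 + MF i ^+ 2) / 2 * lyap k w <= (1 + MF i ^+ 2) / 2 * L.
    by rewrite ler_wpM2l// divr_ge0// addr_ge0.
  move: s1; set s := `|_|; lra.
rewrite ger0_norm; last by rewrite mulr_ge0 ?sqr_ge0// mulr_ge0 ?sqr_ge0.
rewrite ler_wpM2r//.
by rewrite ler_piMr// expr_le1// ltW.
Qed.

Let adr i : adapted (half k) (\1_(dr k i) : T -> R).
Proof. by apply: adapted_indic; exact: draw_half. Qed.

Let acg : adapted (half k) (cur_gain k).
Proof.
apply: adapted_sum => i; apply: adaptedM => //.
by apply: adaptedS (@ga i k); exact: history_half_sub.
Qed.

Let cg_bounds w : 0 <= cur_gain k w <= 1.
Proof. by rewrite /cur_gain sum_draw gain_le1 ltW// gain_gt0. Qed.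

Let ahhalf : adapted (half k) h.
Proof. by apply: adaptedS (@ah); exact: history_half_sub. Qed.

Let step_adapted i : adapted (H k) (step_term i k).
Proof.
apply: adaptedD; apply: adaptedM; try exact: adapted_cst; try exact: slope_adapted.
  by apply: adaptedM => //; exact: adapted_cst.
by apply: adaptedM; [exact: adapted_cst|exact: adaptedX].
Qed.

(** The active player is drawn independently of the past. *)
Let mean_draw i f C : adapted (H k) f -> (forall w, A w -> `|f w| <= C) ->
  \int[P]_w (h w * f w * \1_(dr k i) w) = p i * \int[P]_w (h w * f w).
Proof.
move=> af fC.
have ahf : adapted (H k) (fun w => h w * f w) by exact: adaptedM.
have hf := summable_h af fC.
have hfp : integrable_rv P (fun w => h w * f w * \1_(dr k i) w).
  rewrite (_ : (fun w => _) = fun w => \1_(dr k i) w * (h w * f w)).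
    apply: (@integrable_rvM _ _ _ _ _ _ 1) => //; first exact: toThalf.
    by move=> w; rewrite indicE; case: (_ \in _); rewrite ?normr0 ?normr1.
  by apply/funext => w; rewrite mulrC.
have := @indicator_orthogonal _ _ _ P H (fun k => dr k i) (p i) subH
  (fun k => @draw_history _ _ _ _ _ _ sel smp x k i) 
  (fun k A => @sel_indep _ _ _ _ _ _ _ _ _ _ _ _ sagr k i A) k _ `|C| ahf (h_bounded fC).
under eq_Rintegral do rewrite mulrBr.
rewrite RintegralB//; last by rewrite (_ : _ \o _ = EFin \o (fun w => p i * (h w * f w)));
  [exact: integrable_rvZ|apply/funext => w; rewrite /= mulrC].
by rewrite RintegralZr// => /eqP; rewrite subr_eq0 mulrC => /eqP.
Qed.

Let ncoord j : integrable_rv P (fun w => n k w 0 j).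
Proof. by have [] := C1 asmC k j. Qed.

Let dev_bounded j w : A w -> `|dev k w 0 j| <= L.
Proof.
move=> Aw; have := LA Aw; rewrite /lyap => l1.
have := coord_le_dot (dev k w) j; rewrite -[X in X <= _]real_normK ?num_real//.
set a := `|_|; set b := dot _ _ in l1 * => ab.
have : 0 <= (a - 1) ^+ 2 by exact: sqr_ge0.
have : 0 <= a by exact: normr_ge0.
nra.
Qed.

(** The noise is centered given the active player and the past. *)
Let mean_noise :
  \int[P]_w (h w * cur_gain k w * dot (dev k w) (n k w)) = 0 /\
  integrable_rv P (fun w => h w * cur_gain k w * dot (dev k w) (n k w)).
Proof.
have E w : h w * cur_gain k w * dot (dev k w) (n k w) =
    \sum_j (h w * (cur_gain k w * dev k w 0 j)) * n k w 0 j.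
  by rewrite /dot mulr_sumr; apply: eq_bigr => j _; rewrite !mulrA.
have aj j : adapted (half k) (fun w => h w * (cur_gain k w * dev k w 0 j)).
  apply: adaptedM => //; apply: adaptedM => //.
  by apply: adaptedS (@dev_adapted k j); exact: history_half_sub.
have bj j w : `|h w * (cur_gain k w * dev k w 0 j)| <= `|L|.
  apply: (@h_bounded (fun w => cur_gain k w * dev k w 0 j)) => w' Aw; rewrite normrM.
  have /andP[c0 c1] := cg_bounds w'; rewrite ger0_norm//.
  by apply: le_trans (dev_bounded j Aw); rewrite ler_piMl.
have sj j : integrable_rv P (fun w => (h w * (cur_gain k w * dev k w 0 j)) * n k w 0 j).
  exact: (integrable_rvM (toThalf (@aj j)) (bj j) (ncoord j)).
split; last first.
  by have := integrable_rv_sum (index_enum _) sj; rewrite -(funext E).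
under eq_Rintegral do rewrite E.
rewrite expect_sum//; apply: big1 => j _.
apply: (expect_orthogonal (@subhalf k) (@aj j) (bj j) (ncoord j)) => B sB.
have [_ _ _ ->//] := C1 asmC k j.
by rewrite integral0.
Qed.

Let snn : integrable_rv P (fun w => dot (n k w) (n k w)).
Proof.
have [Y [sn _ _ _] _] := MwP k.
rewrite (_ : (fun w => _) = fun w => enorm (n k w) ^+ 2)//.
by apply/funext => w; rewrite enorm_sqr.
Qed.

Let hg2_bounded w : `|h w * cur_gain k w ^+ 2| <= `|1|.
Proof.
apply: (@h_bounded (fun w => cur_gain k w ^+ 2) 1) => w' _; have /andP[c0 c1] := cg_bounds w'.
by rewrite ger0_norm ?exprn_ge0// expr_le1.
Qed.

Let ahg2 : adapted (half k) (fun w => h w * cur_gain k w ^+ 2).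
Proof. by apply: adaptedM => //; exact: adaptedX. Qed.

Let gM_adapted i : adapted (H k) (fun w => g i k w ^+ 2 * Mw i ^+ 2).
Proof. by apply: adaptedM; [exact: adaptedX|exact: adapted_cst]. Qed.

Let gM_bounded i w : A w -> `|g i k w ^+ 2 * Mw i ^+ 2| <= Mw i ^+ 2.
Proof.
move=> _; have g0 := @gain_gt0 R _ T _ sel i k w.
have g1 := @gain_le1 R _ T _ sel i k w.
rewrite ger0_norm; last by rewrite mulr_ge0 ?sqr_ge0.
rewrite ler_piMl ?sqr_ge0// expr_le1//; exact: ltW.
Qed.

(** The square of the noise is replaced by its conditional expectation, to which
    the bound depending on the active player applies. *)
Let mean_noise_sqr :
  integrable_rv P (fun w => h w * cur_gain k w ^+ 2 * dot (n k w) (n k w)) /\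
  \int[P]_w (h w * cur_gain k w ^+ 2 * dot (n k w) (n k w)) <=
  \sum_i p i * \int[P]_w (h w * (g i k w ^+ 2 * Mw i ^+ 2)).
Proof.
have [Y [_ sY _ condY] YM] := MwP k.
have mh2 : measurable_fun setT (fun w => h w * cur_gain k w ^+ 2) by exact: toThalf.
have s1 := integrable_rvM mh2 hg2_bounded snn.
have s2 := integrable_rvM mh2 hg2_bounded sY.
split=> //.
have -> : \int[P]_w (h w * cur_gain k w ^+ 2 * dot (n k w) (n k w)) =
    \int[P]_w (h w * cur_gain k w ^+ 2 * Y w).
  apply/eqP; rewrite -subr_eq0 -RintegralB//; apply/eqP.
  under eq_Rintegral do rewrite -mulrBr.
  apply: (expect_orthogonal (@subhalf k) ahg2 hg2_bounded); first exact: integrable_rvB.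
  move=> B sB; have mB := subhalf sB.
  have i1 : P.-integrable B (EFin \o fun w => dot (n k w) (n k w)) by exact: integrableS snn.
  have i2 : P.-integrable B (EFin \o Y) by exact: integrableS sY.
  under eq_integral do rewrite EFinB.
  rewrite integralB_EFin// -condY//.
  under eq_integral do rewrite -enorm_sqr.
  rewrite subee//.
  under eq_integral do rewrite enorm_sqr.
  exact: integrable_fin_num.
have sp i : integrable_rv P (fun w => h w * (g i k w ^+ 2 * Mw i ^+ 2) * \1_(dr k i) w).
  rewrite (_ : (fun w => _) = fun w => \1_(dr k i) w * (h w * (g i k w ^+ 2 * Mw i ^+ 2))).
    apply: (@integrable_rvM _ _ _ _ _ _ 1); first exact: toThalf.
      by move=> w; rewrite indicE; case: (_ \in _); rewrite ?normr0 ?normr1.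
    exact: summable_h (@gM_adapted i) (gM_bounded i).
  by apply/funext => w; rewrite mulrC.
have -> : \sum_i p i * \int[P]_w (h w * (g i k w ^+ 2 * Mw i ^+ 2)) =
    \int[P]_w (\sum_i h w * (g i k w ^+ 2 * Mw i ^+ 2) * \1_(dr k i) w).
  rewrite expect_sum//; apply: eq_bigr => i _.
  by rewrite (mean_draw i (@gM_adapted i) (gM_bounded i)).
apply: expect_ae_le => //; first exact: integrable_rv_sum.
apply: filterS YM => w YM.
under eq_bigr do rewrite mulrC.
rewrite sum_draw /cur_gain sum_draw mulrA.
by rewrite ler_wpM2l// mulr_ge0 ?sqr_ge0.
Qed.

Let sgrow : integrable_rv P (fun w => h w * (expR (growth k w) * lyap k w)).
Proof.
have [C C0 gC] := growth_bounded.
apply: (@summable_h (fun w => expR (growth k w) * lyap k w) (expR C * L)).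
  by apply: adaptedM; [apply: adapted_expR; exact: growth_adapted|exact: lyap_adapted].
move=> w Aw; rewrite normrM ger0_norm ?expR_ge0//.
by apply: ler_pM; rewrite ?expR_ge0 ?normr_ge0 ?ler_expR ?gC ?lyap_norm.
Qed.

Let sdrift : integrable_rv P (fun w => h w * (2 * k.+1%:R^-1 * drift k w)).
Proof.
apply: (@summable_h (fun w => 2 * k.+1%:R^-1 * drift k w)
  (`|2 * k.+1%:R^-1| * \sum_i (1 + MF i ^+ 2) / 2 * L)).
  by apply: adaptedM; [exact: adapted_cst|exact: drift_adapted].
move=> w Aw; rewrite normrM ler_wpM2l// driftE.
apply: (le_trans (ler_norm_sum _ _ _)); apply: ler_sum => i _.
apply: (le_trans (slope_le i k w)); rewrite ler_wpM2l ?LA//.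
by rewrite divr_ge0// addr_ge0// sqr_ge0.
Qed.

(** Integrate [lyap_step], replace the indicators of the draws by their
    probabilities, and apply [mean_step]. *)
Lemma expected_step :
  integrable_rv P (fun w => h w * lyap k.+1 w) /\
  \int[P]_w (h w * lyap k.+1 w) <=
  \int[P]_w (h w * (expR (growth k w) * lyap k w - 2 * k.+1%:R^-1 * drift k w)).
Proof.
have [noise0 snoise] := mean_noise.
have [snoise2 noise2] := mean_noise_sqr.
have sl := summable_h (@lyap_adapted k) lyap_norm.
have st i := summable_h (@step_adapted i) (step_bounded i).
have stp i : integrable_rv P (fun w => h w * step_term i k w * \1_(dr k i) w).
  rewrite (_ : (fun w => _) = fun w => \1_(dr k i) w * (h w * step_term i k w)).
    apply: (@integrable_rvM _ _ _ _ _ _ 1) => //; first exact: toThalf.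
    by move=> w; rewrite indicE; case: (_ \in _); rewrite ?normr0 ?normr1.
  by apply/funext => w; rewrite mulrC.
have sg i := summable_h (@gM_adapted i) (gM_bounded i).
pose Phi w := (h w * lyap k w + \sum_i h w * step_term i k w * \1_(dr k i) w
   - 2 * (h w * cur_gain k w * dot (dev k w) (n k w)))
   + 2 * (h w * cur_gain k w ^+ 2 * dot (n k w) (n k w)).
have ss := integrable_rv_sum (index_enum _) stp.
have sPhi : integrable_rv P Phi.
  apply: integrable_rvD; last exact: integrable_rvZ.
  by apply: integrable_rvB; [exact: integrable_rvD|exact: integrable_rvZ].
have lePhi w : h w * lyap k.+1 w <= Phi w.
  apply: (@le_trans _ _ _ _ _ (ler_wpM2l (h0 w) (lyap_step k w))).
  rewrite /Phi le_eqVlt; apply/orP; left; apply/eqP.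
  rewrite mulrDr mulrBr mulrDr mulr_sumr.
  congr (_ + _ - _ + _); [|ring|ring].
  by apply: eq_bigr => i _; ring.
have s1 : integrable_rv P (fun w => h w * lyap k.+1 w).
  apply: (le_integrable measurableT) sPhi.
    apply/measurable_EFinP; apply: measurable_funM; first exact: toT.
    exact: (adapted_measurable (@subH k.+1) (@lyap_adapted k.+1)).
  move=> w _; rewrite lee_fin !ger0_norm//.
    have : 0 <= h w * lyap k.+1 w.
      by rewrite mulr_ge0//; have := lyap_ge1 k.+1 w; lra.
    by move=> /le_trans; exact.
  by rewrite mulr_ge0//; have := lyap_ge1 k.+1 w; lra.
split=> //.
apply: (@le_trans _ _ (\int[P]_w Phi w)); first exact: le_Rintegral.
have -> : \int[P]_w Phi w = \int[P]_w (h w * lyap k w) +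
    \sum_i p i * \int[P]_w (h w * step_term i k w) +
    2 * \int[P]_w (h w * cur_gain k w ^+ 2 * dot (n k w) (n k w)).
  rewrite RintegralD//; last 2 first.
    by apply: integrable_rvB; [exact: integrable_rvD|exact: integrable_rvZ].
    exact: integrable_rvZ.
  rewrite RintegralB//; last 2 first.
    exact: integrable_rvD.
    exact: integrable_rvZ.
  rewrite RintegralD// expect_sum// !RintegralZl// noise0 mulr0 subr0.
  congr (_ + _ + _); apply: eq_bigr => i _.
  exact: mean_draw (@step_adapted i) (step_bounded i).
apply: (@le_trans _ _ (\int[P]_w (h w * lyap k w +
    (\sum_i p i * (h w * step_term i k w) +
    2 * \sum_i p i * (h w * (g i k w ^+ 2 * Mw i ^+ 2)))))).
  have ssp : integrable_rv P (fun w => \sum_i p i * (h w * step_term i k w)).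
    by apply: integrable_rv_sum => i; exact: integrable_rvZ.
  have ssg : integrable_rv P (fun w => \sum_i p i * (h w * (g i k w ^+ 2 * Mw i ^+ 2))).
    by apply: integrable_rv_sum => i; exact: integrable_rvZ.
  rewrite RintegralD//; last by apply: integrable_rvD => //; exact: integrable_rvZ.
  rewrite RintegralD//; last exact: integrable_rvZ.
  rewrite RintegralZl// !expect_sum; try by move=> i; exact: integrable_rvZ.
  rewrite -addrA lerD2l; apply: lerD.
    by apply: ler_sum => i _; rewrite RintegralZl//; exact: (st i).
  rewrite ler_wpM2l//; apply: (le_trans noise2).
  by apply: ler_sum => i _; rewrite RintegralZl//; exact: (sg i).
apply: le_Rintegral => //.
- apply: integrable_rvD => //; apply: integrable_rvD.
    by apply: integrable_rv_sum => i; exact: integrable_rvZ.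
  by apply: integrable_rvZ; apply: integrable_rv_sum => i; exact: integrable_rvZ.
- rewrite (_ : _ \o _ = EFin \o (fun w => h w * (expR (growth k w) * lyap k w) -
      h w * (2 * k.+1%:R^-1 * drift k w))).
    by apply: integrable_rvB; [exact: sgrow|exact: sdrift].
  by apply/funext => w; rewrite /= mulrBr.
- move=> w _; apply: le_trans (ler_wpM2l (h0 w) (mean_step k w)).
  rewrite [leRHS]mulrDr lerD2l !mulr_sumr -big_split/=.
  rewrite le_eqVlt; apply/orP; left; apply/eqP; apply: eq_bigr => i _; ring.
Qed.

Lemma supermartingale_step :
  (\int[P]_(w in A) (potential k.+1 w)%:E + \int[P]_(w in A) (descent k w)%:E <=
   \int[P]_(w in A) (potential k w)%:E)%E.
Proof.
have [s1 le1] := expected_step.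
have mA := subH sA.
have onA (f f' : T -> R) : (forall w, h w * f' w = \1_A w * f w) ->
    integrable_rv P (fun w => h w * f' w) ->
    (\int[P]_(w in A) (f w)%:E = (\int[P]_w (h w * f' w))%:E)%E.
  move=> E sf; rewrite EFin_expect// integral_mkcond; apply: eq_integral => w _.
  by rewrite patchE E indicE; case: ifP => _; rewrite ?mul1r ?mul0r.
rewrite (onA (potential k.+1) (lyap k.+1))//; last first.
  by move=> w; rewrite /h /potential mulrA.
rewrite (onA (descent k) (fun w => 2 * k.+1%:R^-1 * drift k w))//; last first.
  by move=> w; rewrite /h /descent -!mulrA.
rewrite (onA (potential k) (fun w => expR (growth k w) * lyap k w))//; last first.
  move=> w; rewrite /h /potential [cumul k.+1 w]big_ord_recr/= -/(cumul k w) opprD expRD.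
  have : expR (- growth k w) * expR (growth k w) = 1 by rewrite -expRD addNr expR0.
  move: (expR (- growth k w)) (expR (growth k w)) => a b ab.
  transitivity (\1_A w * expR (- cumul k w) * lyap k w * (a * b)); first by ring.
  by rewrite ab; ring.
rewrite -EFinD lee_fin -lerBrDr; apply: (le_trans le1).
rewrite -RintegralB//.
by under eq_Rintegral do rewrite mulrBr.
Qed.

End Supermartingale.

Lemma potential_ae :
  {ae P, forall w, (exists B : R, forall k, potential k w <= B) /\
    exists C : R, forall K, \sum_(k < K) descent k w <= C}.
Proof.
apply: (supermartingale_ae subH (@historyS _ _ _ _ _ _ sel smp x) potential_ge0 descent_ge0
  potential_adapted (fun k => adapted_measurable (@subH k) (@descent_adapted k))).
move=> k A B sA AB; have [C kC] := cumul_bounded k.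
apply: (@supermartingale_step k A (expR C * `|B|)) => // w Aw.
have -> : lyap k w = expR (cumul k w) * potential k w.
  by rewrite mulrA -expRD subrr expR0 mul1r.
apply: ler_pM; rewrite ?expR_ge0 ?potential_ge0 ?ler_expR//.
by apply: le_trans (ler_norm B); exact: AB.
Qed.

Lemma gain_sums_ae i : {ae P, forall w, exists C : R, forall K, \sum_(k < K)
  (`|p i * g i k w - k.+1%:R^-1| + g i k w ^+ 2) <= C}.
Proof.
apply: (@stepsize_sums_ae _ _ _ P H (fun k => dr k i) (p i) subH).
- exact: historyS.
- by move=> k; exact: draw_history.
- exact: prob_bounds.
- by move=> k A; exact: (sel_indep sagr).
Qed.

(** This is where the growth of the update counts enters. *)
Lemma cumul_ae : {ae P, forall w, exists C : R, forall K, cumul K w <= C}.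
Proof.
have all_gains : {ae P, forall w i, exists C : R, forall K, \sum_(k < K)
    (`|p i * g i k w - k.+1%:R^-1| + g i k w ^+ 2) <= C}.
  by apply: filter_forall => i; exact: gain_sums_ae.
apply: filterS all_gains => w /choice[C wC].
pose c i := (1 + MF i ^+ 2) + 2 * (MF i ^+ 2 + Mw i ^+ 2).
exists (\sum_i c i * C i) => K; rewrite /cumul exchange_big/=.
apply: ler_sum => i _.
have c0 : 0 <= c i.
  by rewrite /c; have := sqr_ge0 (MF i); have := sqr_ge0 (Mw i); lra.
apply: le_trans (ler_wpM2l c0 (wC i K)); rewrite mulr_sumr.
apply: ler_sum => t _; have /andP[p0 p1] := prob_bounds i.
have e0 := normr_ge0 (p i * g i t w - t.+1%:R^-1).
have g2 := sqr_ge0 (g i t w).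
have pg : p i * g i t w ^+ 2 <= g i t w ^+ 2 by rewrite ler_piMl.
have F2 := sqr_ge0 (MF i); have W2 := sqr_ge0 (Mw i).
rewrite [leRHS]mulrDr; apply: lerD; first by rewrite ler_wpM2r// /c; lra.
apply: ler_pM => //; first by lra.
- by rewrite mulr_ge0// ltW.
- by rewrite /c; lra.
Qed.

Lemma iterate_subsequence_ae :
  {ae P, forall w, exists2 phi : nat -> nat,
     {homo phi : k l / (k < l)%N >-> (k < l)%N} &
     exists2 a, VI_sol (feasible G) (grad_map P G xi) a &
       x (phi k) w @[k --> \oo] --> a}.
Proof.
move: potential_ae cumul_ae.
apply: filterS2 => w [[B wB] [D wD]] [C wC].
have undo k : lyap k w <= expR C * B.
  have -> : lyap k w = expR (cumul k w) * potential k w.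
    by rewrite mulrA -expRD subrr expR0 mul1r.
  by apply: ler_pM; rewrite ?expR_ge0 ?potential_ge0 ?ler_expR.
apply: (@vi_subsequence _ _ _ _ xs (fun k => x k w) (expR C * B) (expR C * D)) => //.
- exact: closed_feasible.
- by move=> k; apply: le_trans (undo k); rewrite lerDr.
- by move=> k; exact: drift_ge0.
move=> K; apply: le_trans (ler_wpM2l (expR_ge0 C) (wD K)).
rewrite mulr_sumr; apply: ler_sum => k _.
have a0 : 0 <= k.+1%:R^-1 * drift k w by rewrite mulr_ge0 ?drift_ge0.
rewrite /descent mulrA -expRD -/(drift k w) -(mulrA 2).
have e1 : 1 <= expR (C - cumul k.+1 w) by rewrite -expR0 ler_expR subr_ge0.
apply: (@le_trans _ _ (2 * (k.+1%:R^-1 * drift k w))); first by rewrite ler_peMl// ler1n.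
by rewrite ler_peMl// mulr_ge0.
Qed.

End OneStep.

(** * Convergence of a subsequence *)

(* Continuity of F on X is the standing convention for VI(X, F).  The C^1
   condition on f_i(., x_{-i}) only gives continuity in the player's own
   variable, and without joint continuity the claim fails: take N = 2,
   X_1 = X_2 = [0, 1], no noise, F(x) = (a(x_2) x_1, x_2 / 2) with a(0) = 1 and
   a(t) = t / 4 for t > 0, started at (1, 1); here X^* = {(0, 0)}, but almost
   surely x_2^k -> 0 and x_1^k has a positive limit. *)
Theorem theorem4p3 (R : realType) (d : measure_display) (T : measurableType d)
    (P : probability T R) (N m : nat) (xi : T -> 'rV[R]_m) (G : game R N m)
    (p : 'I_N -> R) (sel : nat -> T -> 'I_N) (smp : nat -> T -> 'rV[R]_m)
    (x : nat -> T -> 'rV[R]_(\sum_(i < N) ndim G i)) :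
  random_vector xi ->
  assumptionA P G xi ->
  {within feasible G, continuous (grad_map P G xi)} ->
  acute_angle (feasible G) (grad_map P G xi) ->
  SAGR P xi sel smp x p ->
  assumptionC P xi sel smp x ->
  compact (VI_sol (feasible G) (grad_map P G xi)) ->
  {ae P, forall w, exists2 phi : nat -> nat,
     {homo phi : k l / (k < l)%N >-> (k < l)%N} &
     exists2 xs, QNE P G xi xs & x (phi k) w @[k --> \oo] --> xs}.
Proof.
move=> _ asmA cF acute sagr asmC _.
have convX i : convex_set (strat G i) by have [] := A1 asmA i.
have clX i : closed (strat G i) by have [] := A1 asmA i.
have [_ [xs Sxs]] := A3 asmA.
have /choice[MF MFP] i : exists M : R, forall y, feasible G y ->
    enorm (pgrad i (mean_cost P xi i) y) <= M.
  by have [M _ MP] := C3 asmC i; exists M.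
have [Mw _ MwP] := C2 asmC.
apply: filterS (iterate_subsequence_ae sagr convX clX cF acute asmC MFP MwP Sxs).
by move=> w [phi mono_phi [a Sa cva]]; exists phi => //; exists a => //; exact: VI_sol_QNE.
Qed.
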